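(* Let $\Phi=(A;\{E_i\}_{i=0}^d;A^*;\{E^*_i\}_{i=0}^d)$ be a tridiagonal system on $V$ with diameter $d\geq 1$ that has $q$-Serre type, and regard $V$ as a $U^+_q$-module on which $W_0$ acts as $A$ and $W_1$ acts as $A^*$. Let $\{\mathcal V_i\}_{i=0}^d$ be one of the six decompositions of $V$ listed below (with $\mathcal V_{-1}=\mathcal V_{d+1}=0$). Then for all $k\in\mathbb N$ and $0\leq i\leq d$: (a) for $[0,D]$, $[0^*,D^*]$ and $[0^*,D]$: $G_{k+1}\mathcal V_i\subseteq\mathcal V_{i-1}+\mathcal V_i$ and $\tilde G_{k+1}\mathcal V_i\subseteq \mathcal V_i+\mathcal V_{i+1}$; (b) for $[0^*,0]$: $G_{k+1}\mathcal V_i\subseteq \mathcal V_i$ and $\tilde G_{k+1}\mathcal V_i\subseteq\mathcal V_{i-1}+\mathcal V_i+\mathcal V_{i+1}$; (c) for $[D^*,0]$: $G_{k+1}\mathcal V_i\subseteq \mathcal V_i+\mathcal V_{i+1}$ and $\tilde G_{k+1}\mathcal V_i\subseteq\mathcal V_{i-1}+\mathcal V_i$; (d) for $[D^*,D]$: $G_{k+1}\mathcal V_i\subseteq \mathcal V_{i-1}+\mathcal V_i+\mathcal V_{i+1}$ and $\tilde G_{k+1}\mathcal V_i\subseteq\mathcal V_i$.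
   Context: $\mathbb F$ is a field, $V$ a nonzero finite-dimensional $\mathbb F$-vector space. A tridiagonal (TD) pair on $V$ is an ordered pair $A,A^*\in\mathrm{End}(V)$ such that: (i) each of $A,A^*$ is diagonalizable; (ii) there is an ordering $\{V_i\}_{i=0}^d$ of the eigenspaces of $A$ with $A^*V_i\subseteq V_{i-1}+V_i+V_{i+1}$ ($V_{-1}=V_{d+1}=0$); (iii) there is an ordering $\{V^*_i\}_{i=0}^\delta$ of the eigenspaces of $A^*$ with $AV^*_i\subseteq V^*_{i-1}+V^*_i+V^*_{i+1}$; (iv) there is no subspace $W\neq 0,V$ with $AW\subseteq W$, $A^*W\subseteq W$. Such orderings are called standard. A TD system on $V$ is a sequence $(A;\{E_i\}_{i=0}^d;A^*;\{E^*_i\}_{i=0}^\delta)$ where $A,A^*$ is a TD pair, $\{E_i\}$ are the primitive idempotents of $A$ in a standard ordering and $\{E^*_i\}$ those of $A^*$ in a standard ordering; one always has $d=\delta$ (the diameter). Let $\theta_i$ (resp. $\theta^*_i$) be the eigenvalue of $A$ for $E_i$ (resp. of $A^*$ for $E^*_i$). Fix a nonzero $q$ in the algebraic closure of $\mathbb F$, not a root of unity, with $b=q^2\in\mathbb F$. $\Phi$ has $q$-Serre type if $\theta_i=b\theta_{i-1}$ and $\theta^*_i=b^{-1}\theta^*_{i-1}$ for $1\leq i\leq d$. $U^+_q$ is the $\mathbb F$-algebra with generators $W_0,W_1$ and relations $[W_0,[W_0,[W_0,W_1]_b]_{b^{-1}}]=0$, $[W_1,[W_1,[W_1,W_0]_b]_{b^{-1}}]=0$,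 where $[X,Y]=XY-YX$ and $[X,Y]_b=bXY-YX$. When $\Phi$ has $q$-Serre type, $A,A^*$ satisfy these relations, so $V$ is a $U^+_q$-module with $W_0\mapsto A$, $W_1\mapsto A^*$. The alternating elements $W_{-k},W_{k+1},G_{k+1},\tilde G_{k+1}$ ($k\in\mathbb N$) of $U^+_q$ are defined recursively, in the order $W_0,W_1,G_1,\tilde G_1,W_{-1},W_2,G_2,\tilde G_2,\dots$, with $G_0=\tilde G_0=1$, by: for $n\geq1$, $G_n=\frac{\sum_{k=0}^{n-1}W_{-k}W_{n-k}b^{-k}-\sum_{k=1}^{n-1}G_k\tilde G_{n-k}b^{-k}}{1+b^{-n}}+\frac{[W_n,W_0]}{(1+b^{-n})(1-b^{-1})}$, $\tilde G_n=G_n+\frac{[W_0,W_n]}{1-b^{-1}}$, $W_{-n}=\frac{[W_0,G_n]_b}{b-1}$, $W_{n+1}=\frac{[G_n,W_1]_b}{b-1}$. The six decompositions of $V$ have $i$-th components: $[0,D]$: $E_iV$; $[0^*,D^*]$: $E^*_iV$; $[0^*,0]$: $(E^*_0V+\cdots+E^*_iV)\cap(E_0V+\cdots+E_{d-i}V)$; $[0^*,D]$: $(E^*_0V+\cdots+E^*_iV)\cap(E_iV+\cdots+E_dV)$; $[D^*,0]$: $(E^*_{d-i}V+\cdots+E^*_dV)\cap(E_0V+\cdots+E_{d-i}V)$; $[D^*,D]$: $(E^*_{d-i}V+\cdots+E^*_dV)\cap(E_iV+\cdots+E_dV)$. *)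

(* Defs.v *)
From HB Require Import structures.
From mathcomp Require Import all_boot all_order all_algebra.
From mathcomp Require Import finmap generic_quotient boolp.
From mathcomp.multinomials Require Import monalg.

Set Implicit Arguments.
Unset Strict Implicit.
Unset Printing Implicit Defensive.

Import GRing.Theory.
Local Open Scope ring_scope.
Local Open Scope quotient_scope.

Section Commutators.
Variables (F : fieldType) (R : lalgType F).

Definition comm (x y : R) : R := x * y - y * x.
Definition bcomm (c : F) (x y : R) : R := c *: (x * y) - y * x.
Definition qserre (b : F) (x y : R) : R := comm x (bcomm b^-1 x (bcomm b x y)).

End Commutators.

Lemma qserre_morph (F : fieldType) (R S : lalgType F) (f : R -> S) b x y :
  {morph f : u v / u - v} -> {morph f : u v / u * v} ->
  (forall c u, f (c *: u) = c *: f u) ->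
  f (qserre b x y) = qserre b (f x) (f y).
Proof.
move=> fB fM fZ.
have fC u v : f (comm u v) = comm (f u) (f v) by rewrite /comm fB !fM.
have fbC c u v : f (bcomm c u v) = bcomm c (f u) (f v).
  by rewrite /bcomm fB fZ !fM.
by rewrite /qserre fC !fbC.
Qed.

Lemma qserre_const (F : fieldType) (R : lalgType F) (e : {rmorphism R -> F})
  b x y : e x = 0 -> e (qserre b x y) = 0.
Proof. by move=> ex0; rewrite /qserre /comm rmorphB !rmorphM ex0 mul0r mulr0 subrr. Qed.

Section TDSystem.
Variables (F : fieldType) (V : vectType F).
Implicit Types (X Y A As : 'End(V)) (W : {vspace V}).

Definition diagonalizable_end X : Prop :=
  exists s : seq F, (\sum_(a <- s) passmx.leigenspace X a)%VS = fullv.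

(* U_{i-1} and U_{i+1}, with the convention U_{-1} = U_{d+1} = 0. *)
Definition prev_comp d (U : 'I_d.+1 -> {vspace V}) (i : 'I_d.+1) : {vspace V} :=
  (\sum_(j < d.+1 | j.+1 == i :> nat) U j)%VS.
Definition next_comp d (U : 'I_d.+1 -> {vspace V}) (i : 'I_d.+1) : {vspace V} :=
  (\sum_(j < d.+1 | j == i.+1 :> nat) U j)%VS.

(* An ordering V_0, ..., V_d of the eigenspaces of X is encoded by the
   corresponding ordering of the eigenvalues: V_i = leigenspace X (theta i). *)
Definition eigen_ordering X d (theta : 'I_d.+1 -> F) : Prop :=
  injective theta /\
  forall a : F, passmx.leigenvalue X a <-> exists i, a = theta i.

Definition standard_ordering X Y d (theta : 'I_d.+1 -> F) : Prop :=
  let U i := passmx.leigenspace X (theta i) in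
  eigen_ordering X theta /\
  forall i, (Y @: U i <= prev_comp U i + U i + next_comp U i)%VS.

Record td_pair A As : Prop := TDPair {
  td_diag : diagonalizable_end A;
  td_diags : diagonalizable_end As;
  td_std : exists (d : nat) (theta : 'I_d.+1 -> F),
    standard_ordering A As theta;
  td_stds : exists (delta : nat) (thetas : 'I_delta.+1 -> F),
    standard_ordering As A thetas;
  td_irr : ~ exists W, [/\ W <> 0%VS, W <> fullv,
    (A @: W <= W)%VS & (As @: W <= W)%VS]
}.

(* E i is the projection of V onto the i-th eigenspace of X along the sum of
   the other ones. *)
Definition primitive_idempotents X d (theta : 'I_d.+1 -> F)
    (E : 'I_d.+1 -> 'End(V)) : Prop :=
  forall i j v, v \in passmx.leigenspace X (theta j) ->
    E i v = if j == i then v else 0.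

(* theta i (resp. thetas i) is the eigenvalue of A (resp. As) for E i
   (resp. Es i); it is determined by the other data. *)
Record td_system d A (theta : 'I_d.+1 -> F) (E : 'I_d.+1 -> 'End(V))
    As (thetas : 'I_d.+1 -> F) (Es : 'I_d.+1 -> 'End(V)) : Prop := TDSystem {
  tds_pair : td_pair A As;
  tds_std : standard_ordering A As theta;
  tds_idem : primitive_idempotents A theta E;
  tds_stds : standard_ordering As A thetas;
  tds_idems : primitive_idempotents As thetas Es
}.

Definition qserre_type (b : F) d (theta thetas : 'I_d.+1 -> F) : Prop :=
  forall i j : 'I_d.+1, j = i.+1 :> nat ->
    theta j = b * theta i /\ thetas j = b^-1 * thetas i.

Section Decompositions.
Variables (d : nat) (E Es : 'I_d.+1 -> 'End(V)).

(* E_0 V + ... + E_m V  and  E_m V + ... + E_d V *)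
Definition sum_upto (P : 'I_d.+1 -> 'End(V)) (m : nat) : {vspace V} :=
  (\sum_(j < d.+1 | (j <= m)%N) limg (P j))%VS.
Definition sum_from (P : 'I_d.+1 -> 'End(V)) (m : nat) : {vspace V} :=
  (\sum_(j < d.+1 | (m <= j)%N) limg (P j))%VS.

(* Names: 0, D, 0s, Ds stand for 0, D, 0^*, D^*. *)
Definition dec_0_D (i : 'I_d.+1) : {vspace V} := limg (E i).
Definition dec_0s_Ds (i : 'I_d.+1) : {vspace V} := limg (Es i).
Definition dec_0s_0 (i : 'I_d.+1) : {vspace V} :=
  (sum_upto Es i :&: sum_upto E (d - i))%VS.
Definition dec_0s_D (i : 'I_d.+1) : {vspace V} :=
  (sum_upto Es i :&: sum_from E i)%VS.
Definition dec_Ds_0 (i : 'I_d.+1) : {vspace V} :=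
  (sum_from Es (d - i) :&: sum_upto E (d - i))%VS.
Definition dec_Ds_D (i : 'I_d.+1) : {vspace V} :=
  (sum_from Es (d - i) :&: sum_from E i)%VS.

End Decompositions.

End TDSystem.

Lemma malg_scaleAr (F : fieldType) (M : monomType) (c : F)
    (x y : {malg F[M]}) : c *: (x * y) = x * (c *: y).
Proof.
apply/malgP=> k; rewrite mcoeffZ mcoeffMl.
rewrite (mcoeffMlw _ (fsubset_refl _) (msuppZ_le c y)) mulr_sumr.
apply: eq_bigr => k1 _; rewrite mulr_sumr; apply: eq_bigr => k2 _.
by rewrite mcoeffZ mulrnAr mulrCA.
Qed.

Section AlgebraQuotient.
Variables (F : fieldType) (R : algType F).

Record proper_ideal := ProperIdeal {
  pideal :> R -> Prop;
  pid_zero : pideal 0;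
  pid_add : forall x y, pideal x -> pideal y -> pideal (x + y);
  pid_mull : forall x y, pideal y -> pideal (x * y);
  pid_mulr : forall x y, pideal x -> pideal (x * y);
  pid_one : ~ pideal 1
}.

(* The two-sided ideal generated by a set S. *)
Inductive gen_ideal (S : R -> Prop) : R -> Prop :=
| gid_gen x : S x -> gen_ideal S x
| gid_zero : gen_ideal S 0
| gid_add x y : gen_ideal S x -> gen_ideal S y -> gen_ideal S (x + y)
| gid_mull x y : gen_ideal S y -> gen_ideal S (x * y)
| gid_mulr x y : gen_ideal S x -> gen_ideal S (x * y).

Lemma gen_ideal_ker (e : {rmorphism R -> F}) (S : R -> Prop) :
  (forall x, S x -> e x = 0) -> forall x, gen_ideal S x -> e x = 0.
Proof.
move=> eS x; elim=> {x} [x /eS //|| x y _ x0 _ y0 | x y _ y0 | x y _ x0].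
- by rewrite rmorph0.
- by rewrite rmorphD x0 y0 addr0.
- by rewrite rmorphM y0 mulr0.
- by rewrite rmorphM x0 mul0r.
Qed.

Variable I : proper_ideal.

Lemma pid_opp x : I x -> I (- x).
Proof. by move=> Ix; rewrite -mulN1r; apply: pid_mull. Qed.

Lemma pid_scale c x : I x -> I (c *: x).
Proof. by move=> Ix; rewrite -mulr_algl; apply: pid_mull. Qed.

Definition ideal_eq : rel R := fun x y => `[< I (x - y) >].

Lemma ideal_eq_refl : reflexive ideal_eq.
Proof. by move=> x; apply/asboolP; rewrite subrr; apply: pid_zero. Qed.

Lemma ideal_eq_sym : symmetric ideal_eq.
Proof.
have h x y : ideal_eq x y -> ideal_eq y x.
  by move=> /asboolP /pid_opp Ixy; apply/asboolP; rewrite opprB in Ixy.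
by move=> x y; apply/idP/idP; apply: h.
Qed.

Lemma ideal_eq_trans : transitive ideal_eq.
Proof.
move=> y x z /asboolP Ixy /asboolP Iyz; apply/asboolP.
by have := pid_add Ixy Iyz; rewrite addrA subrK.
Qed.

Canonical ideal_equiv :=
  EquivRel ideal_eq ideal_eq_refl ideal_eq_sym ideal_eq_trans.

Definition alg_quot := {eq_quot ideal_equiv}.
HB.instance Definition _ := Choice.on alg_quot.
HB.instance Definition _ : EqQuotient R ideal_equiv alg_quot :=
  EqQuotient.on alg_quot.

Definition qproj (x : R) : alg_quot := \pi_alg_quot x.

Lemma qproj_eqP (x y : R) : qproj x = qproj y <-> I (x - y).
Proof.
by split=> [/eqquotP /asboolP | Ixy]; last by apply/eqquotP/asboolP.
Qed.

Lemma qproj_surj (u : alg_quot) : exists x, u = qproj x.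
Proof. by exists (repr u); rewrite /qproj reprK. Qed.

Let zeroq : alg_quot := qproj 0.
Let oneq : alg_quot := qproj 1.
Let oppq (u : alg_quot) : alg_quot := qproj (- repr u).
Let addq (u v : alg_quot) : alg_quot := qproj (repr u + repr v).
Let mulq (u v : alg_quot) : alg_quot := qproj (repr u * repr v).
Let scaleq (c : F) (u : alg_quot) : alg_quot := qproj (c *: repr u).

Let repr_sub (x : R) : I (repr (qproj x) - x).
Proof. by apply/qproj_eqP; rewrite /qproj reprK. Qed.

Let oppqE x : oppq (qproj x) = qproj (- x).
Proof. by apply/qproj_eqP; rewrite -opprD; apply/pid_opp/repr_sub. Qed.

Let addqE x y : addq (qproj x) (qproj y) = qproj (x + y).
Proof.
by apply/qproj_eqP; rewrite opprD addrACA; apply: pid_add; apply: repr_sub.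
Qed.

Let mulqE x y : mulq (qproj x) (qproj y) = qproj (x * y).
Proof.
apply/qproj_eqP; set x' := repr _; set y' := repr _.
have -> : x' * y' - x * y = (x' - x) * y' + x * (y' - y).
  by rewrite mulrBl mulrBr addrA subrK.
by apply: pid_add; [apply: pid_mulr|apply: pid_mull]; apply: repr_sub.
Qed.

Let scaleqE c x : scaleq c (qproj x) = qproj (c *: x).
Proof. by apply/qproj_eqP; rewrite -scalerBr; apply/pid_scale/repr_sub. Qed.

Ltac qlift := repeat (let u := fresh "u" in move=> u; case: (qproj_surj u) => ? ->).

Fact addqA : associative addq.
Proof. by qlift; rewrite !addqE addrA. Qed.
Fact addqC : commutative addq.
Proof. by qlift; rewrite !addqE addrC. Qed.
Fact add0q : left_id zeroq addq.
Proof. by qlift; rewrite !addqE add0r. Qed.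
Fact addNq : left_inverse zeroq oppq addq.
Proof. by qlift; rewrite oppqE addqE addNr. Qed.
HB.instance Definition _ :=
  GRing.isZmodule.Build alg_quot addqA addqC add0q addNq.

Fact mulqA : associative mulq.
Proof. by qlift; rewrite !mulqE mulrA. Qed.
Fact mul1q : left_id oneq mulq.
Proof. by qlift; rewrite !mulqE mul1r. Qed.
Fact mulq1 : right_id oneq mulq.
Proof. by qlift; rewrite !mulqE mulr1. Qed.
Fact mulqDl : left_distributive mulq addq.
Proof. by qlift; rewrite !(mulqE, addqE) mulrDl. Qed.
Fact mulqDr : right_distributive mulq addq.
Proof. by qlift; rewrite !(mulqE, addqE) mulrDr. Qed.
Fact oneq_neq0 : oneq != zeroq.
Proof. by apply/eqP=> /qproj_eqP; rewrite subr0; apply: pid_one. Qed.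
HB.instance Definition _ := GRing.Zmodule_isNzRing.Build alg_quot
  mulqA mul1q mulq1 mulqDl mulqDr oneq_neq0.

Lemma qproj0 : qproj 0 = 0. Proof. by []. Qed.
Lemma qproj1 : qproj 1 = 1. Proof. by []. Qed.
Lemma qprojN x : qproj (- x) = - qproj x.
Proof. by rewrite -oppqE. Qed.
Lemma qprojD x y : qproj (x + y) = qproj x + qproj y.
Proof. by rewrite -addqE. Qed.
Lemma qprojB x y : qproj (x - y) = qproj x - qproj y.
Proof. by rewrite qprojD qprojN. Qed.
Lemma qprojM x y : qproj (x * y) = qproj x * qproj y.
Proof. by rewrite -mulqE. Qed.

Fact scaleqA (a c : F) u : scaleq a (scaleq c u) = scaleq (a * c) u.
Proof. by case: (qproj_surj u) => x ->; rewrite !scaleqE scalerA. Qed.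
Fact scale1q : left_id 1 scaleq.
Proof. by qlift; rewrite scaleqE scale1r. Qed.
Fact scaleqDr : right_distributive scaleq +%R.
Proof.
by move=> c; qlift; rewrite -qprojD !scaleqE scalerDr qprojD.
Qed.
Fact scaleqDl u : {morph scaleq^~ u : a c / a + c >-> a + c}.
Proof.
by case: (qproj_surj u) => x -> a c; rewrite !scaleqE scalerDl qprojD.
Qed.
HB.instance Definition _ := GRing.Zmodule_isLmodule.Build F alg_quot
  scaleqA scale1q scaleqDr scaleqDl.

Lemma qprojZ (c : F) (x : R) : qproj (c *: x) = c *: qproj x.
Proof. by rewrite -scaleqE. Qed.

Fact scaleqAl (c : F) (u v : alg_quot) : c *: (u * v) = (c *: u) * v.
Proof.
by move: u v; qlift; rewrite -qprojM -!qprojZ -qprojM scalerAl.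
Qed.
HB.instance Definition _ :=
  GRing.Lmodule_isLalgebra.Build F alg_quot scaleqAl.

Fact scaleqAr (c : F) (u v : alg_quot) : c *: (u * v) = u * (c *: v).
Proof.
by move: u v; qlift; rewrite -qprojM -!qprojZ -qprojM scalerAr.
Qed.
HB.instance Definition _ :=
  GRing.Lalgebra_isAlgebra.Build F alg_quot scaleqAr.

End AlgebraQuotient.

(* The alternating elements, for two elements W0, W1 of an algebra R. *)
Section Alternating.
Variables (F : fieldType) (b : F) (R : algType F) (W0 W1 : R).

(* The recursion is carried by quadruples
     (W_{-k}, W_{k+1}, G_k, tilde G_k);
   alt_step computes the n-th one (n >= 1) from the previous ones, and
   alt_upto n is correct at all k <= n. *)
Record alt_quad := AltQuad { aqWm : R; aqWp : R; aqG : R; aqGt : R }.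

Definition alt_step (n : nat) (w : nat -> alt_quad) : alt_quad :=
  let Wn := aqWp (w n.-1) in
  let g := (1 + b ^- n)^-1 *:
      (\sum_(0 <= k < n) b ^- k *: (aqWm (w k) * aqWp (w (n - k).-1))
       - \sum_(1 <= k < n) b ^- k *: (aqG (w k) * aqGt (w (n - k)%N)))
    + ((1 + b ^- n) * (1 - b^-1))^-1 *: comm Wn W0 in
  let gt := g + (1 - b^-1)^-1 *: comm W0 Wn in
  AltQuad ((b - 1)^-1 *: bcomm b W0 g) ((b - 1)^-1 *: bcomm b g W1) g gt.

Fixpoint alt_upto (n : nat) : nat -> alt_quad :=
  if n is m.+1 then
    fun k => if (k <= m)%N then alt_upto m k else alt_step m.+1 (alt_upto m)
  else fun=> AltQuad W0 W1 1 1.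

Definition alt (k : nat) : alt_quad := alt_upto k k.

(* altWm k = W_{-k}, altWp k = W_{k+1}, altG k = G_k, altGt k = tilde G_k *)
Definition altWm (k : nat) : R := aqWm (alt k).
Definition altWp (k : nat) : R := aqWp (alt k).
Definition altG (k : nat) : R := aqG (alt k).
Definition altGt (k : nat) : R := aqGt (alt k).

Lemma alt_uptoE n k : (k <= n)%N -> alt_upto n k = alt k.
Proof.
elim: n => [|n IHn]; first by rewrite leqn0 => /eqP ->.
rewrite leq_eqVlt => /orP [/eqP -> // | ]; rewrite ltnS => le_kn /=.
by rewrite le_kn IHn.
Qed.

Lemma altE n : alt n.+1 = alt_step n.+1 (alt_upto n).
Proof. by rewrite /alt /= ltnn. Qed.

Lemma alt0E : [/\ altWm 0 = W0, altWp 0 = W1, altG 0 = 1 & altGt 0 = 1].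
Proof. by []. Qed.

Lemma altG_rec n : (0 < n)%N ->
  altG n = (1 + b ^- n)^-1 *:
      (\sum_(0 <= k < n) b ^- k *: (altWm k * altWp (n - k).-1)
       - \sum_(1 <= k < n) b ^- k *: (altG k * altGt (n - k)%N))
    + ((1 + b ^- n) * (1 - b^-1))^-1 *: comm (altWp n.-1) W0.
Proof.
case: n => // n _; rewrite {1}/altG altE /alt_step.
set u := alt_upto n; rewrite [aqG _]/=.
have uE k : (k <= n)%N -> u k = alt k by exact: alt_uptoE.
rewrite /altWp -uE //; congr (_ *: (_ - _) + _); apply: eq_big_nat => k.
  case/andP=> _ lt_kn; rewrite !uE //.
  by rewrite -subnS subSS leq_subr.
by case/andP=> lt_0k lt_kn; rewrite !uE // leq_subLR -add1n leq_add2r.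
Qed.

Lemma altGt_rec n : (0 < n)%N ->
  altGt n = altG n + (1 - b^-1)^-1 *: comm W0 (altWp n.-1).
Proof.
by case: n => // n _; rewrite /altGt /altG altE /= -/(alt n).
Qed.

Lemma altWm_rec n : (0 < n)%N -> altWm n = (b - 1)^-1 *: bcomm b W0 (altG n).
Proof. by case: n => // n _; rewrite /altWm /altG altE. Qed.

Lemma altWp_rec n : (0 < n)%N -> altWp n = (b - 1)^-1 *: bcomm b (altG n) W1.
Proof. by case: n => // n _; rewrite /altWp /altG altE. Qed.

End Alternating.

Section UqPlus.
Variables (F : fieldType) (b : F).

(* The free F-algebra on two generators, indexed by bool:
   false stands for W_0 and true for W_1. *)
Definition free2 := {malg F[{fmonom bool}]}.
HB.instance Definition _ := GRing.Lalgebra.on free2.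
HB.instance Definition _ :=
  GRing.Lalgebra_isAlgebra.Build F free2 (@malg_scaleAr F {fmonom bool}).

Definition fgen (i : bool) : free2 := << fmu i >>.

Definition fconst : {rmorphism free2 -> F} := @mcoeff {fmonom bool} F mone.

Lemma fconst_gen i : fconst (fgen i) = 0.
Proof.
by rewrite /fconst /= mcoeffU1; case: eqP => // /(congr1 (@fdeg _));
   rewrite fdegU fdeg1.
Qed.

Definition qserre_relator (x : free2) : Prop :=
  x = qserre b (fgen false) (fgen true) \/
  x = qserre b (fgen true) (fgen false).

Lemma qserre_ideal_proper : ~ gen_ideal qserre_relator 1.
Proof.
have S0 x : qserre_relator x -> fconst x = 0.
  by case=> ->; apply: qserre_const; apply: fconst_gen.
by move/(gen_ideal_ker S0)/eqP; rewrite rmorph1 oner_eq0.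
Qed.

Definition qserre_ideal : proper_ideal free2 :=
  ProperIdeal (@gid_zero _ _ _) (@gid_add _ _ _) (@gid_mull _ _ _)
    (@gid_mulr _ _ _) qserre_ideal_proper.

(* U_q^+, which depends on q only through b = q^2. *)
Definition Uqp := alg_quot qserre_ideal.
HB.instance Definition _ := GRing.Algebra.on Uqp.

Definition W0 : Uqp := qproj qserre_ideal (fgen false).
Definition W1 : Uqp := qproj qserre_ideal (fgen true).

Lemma Uqp_rel0 : qserre b W0 W1 = 0.
Proof.
rewrite -(qserre_morph _ _ _ (@qprojB _ _ _) (@qprojM _ _ _) (@qprojZ _ _ _)).
by apply/qproj_eqP; rewrite subr0; apply/gid_gen; left.
Qed.

Lemma Uqp_rel1 : qserre b W1 W0 = 0.
Proof.
rewrite -(qserre_morph _ _ _ (@qprojB _ _ _) (@qprojM _ _ _) (@qprojZ _ _ _)).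
by apply/qproj_eqP; rewrite subr0; apply/gid_gen; right.
Qed.

(* G_k and tilde G_k in U_q^+ *)
Definition UG (k : nat) : Uqp := altG b W0 W1 k.
Definition UGt (k : nat) : Uqp := altGt b W0 W1 k.

End UqPlus.

(* An F-linear module structure of the algebra U on V, given as the algebra
   homomorphism U -> End(V). *)
Record module_action (F : fieldType) (U : algType F) (V : vectType F)
    (act : U -> 'End(V)) : Prop := ModuleAction {
  act_linear : linear act;
  act_one : act 1 = \1%VF;
  act_mul : forall x y, act (x * y) = (act x \o act y)%VF
}.

(* Main.v *)
From HB Require Import structures.
Require Import Defs.
From mathcomp Require Import all_boot all_order all_algebra.
From mathcomp Require Import boolp zify ring.

Set Implicit Arguments.
Unset Strict Implicit.
Unset Printing Implicit Defensive.

Import GRing.Theory.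
Local Open Scope ring_scope.

(* Let psi_1 be proportional to the b-commutator b^-1 W_0 W_1 - W_1 W_0, and let
   x_n, y_n (the real root vectors of Damiani) be obtained from W_0, W_1 by
   iterating ad psi_1.  The q-Serre relations say that x_1 x_0 = b x_0 x_1 and
   y_0 y_1 = b y_1 y_0; by induction on n they force b^-1 x_i y_j - y_j x_i to
   depend only on i + j = n, which defines psi_{n+1}, and the psi_n commute and
   act on the x_j and y_j by conjugation through
     psi(t) x_j psi(t)^-1 = (1 - b^-1 t S) / (1 - b t S) x_j,  S x_j = x_{j+1}.
   The recursion for the alternating elements is solved by the series G(t) with
   G(t) G(t/b) psi(t) = 1, together with W^-(t) = x(t) G(t), W^+(t) = G(t) y(t)
   and tilde G(t) = G(t) + t [W_0, W^+(t)] / (1 - b^-1).  Hence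
     [W_0, [W_0, G_n]_b] = 0 = [W_0, [tilde G_n, W_0]_b],
     [W_1, [G_n, W_1]_b] = 0 = [W_1, [W_1, tilde G_n]_b],
   where the second line follows from the first one in the opposite algebra.

   On V these relations are quadratic in the eigenvalues: G_n lowers and
   tilde G_n raises the index by at most one, for both families of eigenspaces.
   The split decompositions inherit this because the sums over i of
   (V*_0 + ... + V*_i) /\ (V_{i+r} + ... + V_d) are invariant under A and A*,
   hence zero for r > 0 and everything for r = 0. *)

(** * Identities in noncommutative algebras *)

Inductive nc_expr (F : Type) :=
| NcAtom of nat
| NcZero
| NcOne
| NcAdd of nc_expr F & nc_expr F
| NcOpp of nc_expr F
| NcMul of nc_expr F & nc_expr F
| NcScale of F & nc_expr F.

Section NoncommutativeNormalForm.
Variables (F : fieldType) (R : algType F) (env : seq R).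

Fixpoint nc_eval (e : nc_expr F) : R :=
  match e with
  | NcAtom i => nth 0 env i
  | NcZero => 0
  | NcOne => 1
  | NcAdd e1 e2 => nc_eval e1 + nc_eval e2
  | NcOpp e1 => - nc_eval e1
  | NcMul e1 e2 => nc_eval e1 * nc_eval e2
  | NcScale c e1 => c *: nc_eval e1
  end.

Fixpoint nc_norm (e : nc_expr F) : seq (F * seq nat) :=
  match e with
  | NcAtom i => [:: (1, [:: i])]
  | NcZero => [::]
  | NcOne => [:: (1, [::])]
  | NcAdd e1 e2 => nc_norm e1 ++ nc_norm e2
  | NcOpp e1 => map (fun m => (- m.1, m.2)) (nc_norm e1)
  | NcMul e1 e2 => flatten (map (fun m1 =>
      map (fun m2 => (m1.1 * m2.1, m1.2 ++ m2.2)) (nc_norm e2)) (nc_norm e1))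
  | NcScale c e1 => map (fun m => (c * m.1, m.2)) (nc_norm e1)
  end.

Fixpoint nc_same_word (u v : seq nat) : bool :=
  match u, v with
  | [::], [::] => true
  | i :: u', j :: v' => if Nat.eqb i j then nc_same_word u' v' else false
  | _, _ => false
  end.

Fixpoint nc_insert (m : F * seq nat) (s : seq (F * seq nat)) :=
  if s is m' :: s' then
    if nc_same_word m.2 m'.2 then (m.1 + m'.1, m'.2) :: s'
    else m' :: nc_insert m s'
  else [:: m].

(** One equation in [F] per word, kept as a proposition: the coefficients contain parameters, so
    they are left to [ring] and [field] instead of being compared by computation. *)
Definition nc_null (s : seq (F * seq nat)) : Prop :=
  foldr (fun m P => m.1 = 0 /\ P) True (foldr nc_insert [::] s).

Let mono (m : F * seq nat) : R := m.1 *: \prod_(i <- m.2) nth 0 env i.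

Lemma nc_normE e : nc_eval e = \sum_(m <- nc_norm e) mono m.
Proof.
elim: e => /= [i|||e1 -> e2 ->|e1 ->|e1 -> e2 ->|c e1 ->].
- by rewrite big_seq1 /mono big_seq1 scale1r.
- by rewrite big_nil.
- by rewrite big_seq1 /mono big_nil scale1r.
- by rewrite big_cat.
- by rewrite big_map -sumrN; apply: eq_bigr => m _; rewrite /mono scaleNr.
- rewrite big_flatten big_map mulr_suml; apply: eq_bigr => m1 _.
  rewrite big_map mulr_sumr; apply: eq_bigr => m2 _.
  by rewrite /mono big_cat /= -scalerAl -scalerAr scalerA.
- by rewrite big_map scaler_sumr; apply: eq_bigr => m _; rewrite /mono scalerA.
Qed.

Lemma nc_same_wordP u v : nc_same_word u v -> u = v.
Proof.
by elim: u v => [|i u IHu] [|j v] //=; case: PeanoNat.Nat.eqb_spec => // -> /IHu ->.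
Qed.

Lemma nc_insertE m s :
  \sum_(m' <- nc_insert m s) mono m' = mono m + \sum_(m' <- s) mono m'.
Proof.
elim: s => [|m' s IHs] /=; first by rewrite big_seq1 big_nil addr0.
case: ifP => [/nc_same_wordP Em | _]; last by rewrite !big_cons IHs addrCA.
by rewrite !big_cons addrA /mono Em -scalerDl.
Qed.

Lemma nc_eq e1 e2 :
  nc_null (nc_norm (NcAdd e1 (NcOpp e2))) -> nc_eval e1 = nc_eval e2.
Proof.
rewrite /nc_null => e0; apply/eqP; rewrite -subr_eq0; apply/eqP.
have -> : nc_eval e1 - nc_eval e2 = nc_eval (NcAdd e1 (NcOpp e2)) by [].
rewrite nc_normE; move: (nc_norm _) e0 => s.
have -> : \sum_(m <- s) mono m = \sum_(m <- foldr nc_insert [::] s) mono m.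
  by elim: s => [|m s IHs] /=; rewrite ?nc_insertE ?big_cons ?IHs.
elim: (foldr (@nc_insert) _ _) => [|m r IHr] /=; first by rewrite big_nil.
by case=> m0 /IHr r0; rewrite big_cons r0 /mono m0 scale0r addr0.
Qed.

End NoncommutativeNormalForm.

Ltac nc_index x env :=
  match env with
  | x :: _ => constr:(O)
  | _ :: ?env' => let n := nc_index x env' in constr:(S n)
  end.

Ltac nc_atoms t env :=
  match t with
  | @GRing.zero _ => env
  | @GRing.one _ => env
  | @GRing.add _ ?u ?v => let env' := nc_atoms u env in nc_atoms v env'
  | @GRing.opp _ ?u => nc_atoms u env
  | @GRing.mul _ ?u ?v => let env' := nc_atoms u env in nc_atoms v env'
  | @GRing.scale _ _ _ ?u => nc_atoms u env
  | _ => match env with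
         | context [t :: _] => env
         | _ => constr:(t :: env)
         end
  end.

Ltac nc_reify F t env :=
  match t with
  | @GRing.zero _ => constr:(@NcZero F)
  | @GRing.one _ => constr:(@NcOne F)
  | @GRing.add _ ?u ?v =>
    let u' := nc_reify F u env in let v' := nc_reify F v env in
    constr:(@NcAdd F u' v')
  | @GRing.opp _ ?u => let u' := nc_reify F u env in constr:(@NcOpp F u')
  | @GRing.mul _ ?u ?v =>
    let u' := nc_reify F u env in let v' := nc_reify F v env in
    constr:(@NcMul F u' v')
  | @GRing.scale _ _ ?c ?u =>
    let u' := nc_reify F u env in constr:(@NcScale F c u')
  | _ => let i := nc_index t env in constr:(@NcAtom F i)
  end.

(* Reduces an equality in an F-algebra R to the equality of the coefficients
   of every noncommutative monomial. *)
Ltac nc_coefs F R :=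
  match goal with |- @eq _ ?u ?v =>
    let env := nc_atoms u (@nil (GRing.Algebra.sort R)) in
    let env := nc_atoms v env in
    let u' := nc_reify F u env in
    let v' := nc_reify F v env in
    apply: (@nc_eq F R env u' v');
    cbv [nc_null nc_norm nc_insert nc_same_word Nat.eqb
         cat map flatten foldr fst snd];
    repeat split
  end.

(** The pattern of the noncommutative computations below: [e] is an explicit combination of relators
    already known to vanish, and [u - v = e] is then an identity in a free algebra, within reach of
    [nc_coefs]. *)
Lemma eq_of_null (V : zmodType) (e u v : V) : e = 0 -> u - v = e -> u = v.
Proof. by move=> -> /eqP; rewrite subr_eq0 => /eqP. Qed.

Lemma eq_subr0 (V : zmodType) (u v : V) : u = v -> u - v = 0.
Proof. by move=> ->; rewrite subrr. Qed.

(** * Root vectors *)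

Lemma sum_triangle (V : zmodType) (f : nat -> nat -> V) n :
  \sum_(k < n.+1) \sum_(l < (n - k).+1) f k l =
  \sum_(m < n.+1) \sum_(k < m.+1) f k (m - k)%N.
Proof.
elim: n => [|n IHn]; first by rewrite !big_ord1.
rewrite big_ord_recr [RHS]big_ord_recr /= -IHn.
rewrite (_ : \sum_(l < (n.+1 - n.+1).+1) f n.+1 l = f n.+1 0%N); last first.
  by rewrite subnn big_ord1.
under eq_bigr => k _.
  have -> : ((n.+1 - k).+1 = (n - k).+2)%N by rewrite subSn // -ltnS.
  rewrite big_ord_recr /=; over.
rewrite big_split /= -addrA; congr (_ + _).
rewrite [RHS]big_ord_recr /= subnn; congr (_ + _).
by apply: eq_bigr => k _; rewrite -subSn // -ltnS.
Qed.

Lemma sum_antidiag_rev (V : zmodType) (f : nat -> nat -> V) n :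
  \sum_(k < n.+1) f k (n - k)%N = \sum_(k < n.+1) f (n - k)%N k.
Proof.
rewrite (reindex_inj rev_ord_inj) /=; apply: eq_bigr => k _.
by rewrite subSS subKn // -ltnS.
Qed.

(* Coefficients of (1 - r z) / (1 - p z). *)
Definition qcoef (F : fieldType) (p r : F) (k : nat) : F :=
  if k is k'.+1 then (p - r) * p ^+ k' else 1.

Section QCoef.
Variable F : fieldType.
Implicit Types p r b : F.

Lemma qcoefS p r k : qcoef p r k.+1 = p * qcoef p r k - (k == 0%N)%:R * r.
Proof. by case: k => [|k] /=; rewrite ?expr0 ?exprS; ring. Qed.

(** The two factors are the coefficients of (1 - z/b)/(1 - bz) and of its inverse. *)
Lemma qcoef_conv b n : b != 0 ->
  \sum_(k < n.+1) qcoef b b^-1 k * qcoef b^-1 b (n - k) = (n == 0%N)%:R.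
Proof.
move=> b0; elim: n => [|n IHn]; first by rewrite big_ord1 mulr1.
rewrite big_ord_recl subn0 mul1r.
under eq_bigr => k _ do rewrite lift0 qcoefS mulrBl -mulrA subSS.
rewrite sumrB -mulr_sumr IHn big_ord_recl /= big1 ?addr0 => [|k _]; last first.
  by rewrite mul0r mul0r.
by rewrite subn0; case: n {IHn} => [|n] /=; rewrite ?expr0 ?exprS; field.
Qed.

(** With Q(z) = (1 - z/b)/(1 - bz), the sum is the coefficient of z^n in z Q'(z)/Q(z) = bz/(1 - bz)
    - (z/b)/(1 - z/b). *)
Lemma qcoef_conv_deriv b n : b != 0 ->
  \sum_(k < n.+1) k%:R * (qcoef b b^-1 k * qcoef b^-1 b (n - k)) =
  b ^+ n - b ^- n.
Proof.
move=> b0; elim: n => [|n IHn]; first by rewrite big_ord1 mul0r expr0 invr1 subrr.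
rewrite big_ord_recl mul0r add0r.
under eq_bigr => k _.
  rewrite subSS lift0.
  rewrite (_ : _ * _ = b * (k%:R * (qcoef b b^-1 k * qcoef b^-1 b (n - k))) +
      b * (qcoef b b^-1 k * qcoef b^-1 b (n - k)) -
      (nat_of_ord k == 0%N)%:R * (b^-1 * qcoef b^-1 b (n - k))); last first.
    by rewrite qcoefS -natr1; case: k => -[|k] ltkn /=; ring.
  over.
rewrite sumrB big_split /= -!mulr_sumr IHn qcoef_conv //.
rewrite big_ord_recl /= big1 ?addr0 => [|k _]; last by rewrite mul0r.
rewrite subn0 mul1r; case: n {IHn} => [|n] /=; rewrite !(expr0, exprS, invfM, exprVn).
  by rewrite invr1; field.
by field; rewrite expf_neq0 ?b0.
Qed.

(** The hypothesis reads psi(t) (1 - p t S) x_j = (1 - r t S) x_j psi(t), where S x_j = x_{j+1};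
    inverting 1 - p t S moves psi past x_j. The bound [N] allows the use inside an induction that
    knows the hypothesis only up to some degree. *)
Lemma qcoef_expand (R : algType F) p r (psi x : nat -> R) N :
  psi 0%N = 1 ->
  (forall n j, (n.+1 + j <= N)%N ->
     psi n.+1 * x j - p *: (psi n * x j.+1) =
     x j * psi n.+1 - r *: (x j.+1 * psi n)) ->
  forall n j, (n + j <= N)%N ->
  psi n * x j = \sum_(k < n.+1) qcoef p r k *: (x (j + k)%N * psi (n - k)%N).
Proof.
move=> psi0 Hpsi; elim=> [|n IHn] j le_njN.
  by rewrite big_ord1 /= psi0 mul1r addn0 mulr1 scale1r.
rewrite big_ord_recl subn0 addn0 scale1r.
under eq_bigr => k _ do
  rewrite lift0 qcoefS subSS addnS -addSn scalerBl -!scalerA.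
rewrite sumrB -scaler_sumr -IHn; last by rewrite addnS -addSn.
rewrite big_ord_recl big1 => [|k _]; last by rewrite scale0r.
rewrite /= ?addn0 ?subn0 ?scale1r ?addr0.
by apply: (eq_of_null (eq_subr0 (Hpsi n j le_njN))); nc_coefs F R; ring.
Qed.

End QCoef.

(** * Root vectors attached to two elements that satisfy the q-Serre relations *)

Section ImaginaryRootVectors.
Variables (F : fieldType) (b : F) (R : algType F) (x0 y0 : R).
Hypothesis b_neq0 : b != 0.
Hypothesis b_nonroot : forall n, (0 < n)%N -> b ^+ n != 1.
Hypothesis serre_xy : qserre b x0 y0 = 0.
Hypothesis serre_yx : qserre b y0 x0 = 0.

Let c : F := b - b^-1.

Lemma subV_neq0 : c != 0.
Proof.
rewrite /c subr_eq0; apply: contra (@b_nonroot 2 isT) => /eqP bV.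
by rewrite expr2 {2}bV divff.
Qed.
Let c_neq0 := subV_neq0.

Lemma sub1_neq0 : b - 1 != 0.
Proof. by rewrite subr_eq0; exact: (@b_nonroot 1). Qed.

Definition qbracket (u v : R) : R :=
  (1 - b^-1)^-1 *: (b^-1 *: (u * v) - v * u).

Let psi1 : R := qbracket x0 y0.

Fixpoint rootx (n : nat) : R :=
  if n is m.+1 then c^-1 *: comm psi1 (rootx m) else x0.
Fixpoint rooty (n : nat) : R :=
  if n is m.+1 then (- c^-1) *: comm psi1 (rooty m) else y0.

Local Notation x := rootx.
Local Notation y := rooty.

(** psi_{n+1} is taken from the bracket with k = 0 among those of x_k and y_l with k + l = n;
    [qbracket_sum] shows that they all agree. *)
Definition rootpsi (n : nat) : R := if n is m.+1 then qbracket (x 0) (y m) else 1.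
Local Notation psi := rootpsi.

Lemma psi1_x n : psi1 * x n = x n * psi1 + c *: x n.+1.
Proof. by rewrite /= scalerA divff // scale1r /comm addrC subrK. Qed.

Lemma psi1_y n : psi1 * y n = y n * psi1 - c *: y n.+1.
Proof.
by rewrite /= scaleNr scalerN opprK scalerA divff // scale1r /comm addrC subrK.
Qed.

Lemma x1_x0 : x 1 * x 0 = b *: (x 0 * x 1).
Proof.
apply: (@eq_of_null _ (c^-1 *: ((1 - b^-1)^-1 *: qserre b x0 y0))).
  by rewrite serre_xy !scaler0.
rewrite /= /comm /psi1 /qserre /bcomm /comm /qbracket.
by nc_coefs F R; field; rewrite b_neq0 sub1_neq0.
Qed.

Lemma y0_y1 : y 0 * y 1 = b *: (y 1 * y 0).
Proof.
apply: (@eq_of_null _ (- c^-1 *: ((1 - b^-1)^-1 *: qserre b y0 x0))).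
  by rewrite serre_yx !scaler0.
rewrite /= /comm /psi1 /qserre /bcomm /comm /qbracket.
by nc_coefs F R; field; rewrite b_neq0 sub1_neq0.
Qed.

(** Bracketing with psi_1 is a derivation that raises the index of [x] with factor c and that of [y]
    with factor -c. *)
Lemma psi1_qbracket k l :
  comm psi1 (qbracket (x k) (y l)) =
  c *: (qbracket (x k.+1) (y l) - qbracket (x k) (y l.+1)).
Proof.
have Ex := eq_subr0 (psi1_x k); have Ey := eq_subr0 (psi1_y l).
move: Ex Ey; rewrite /comm /qbracket.
set u := x k; set v := y l; set u' := x k.+1; set v' := y l.+1; set p := psi1.
move=> Ex Ey.
apply: (@eq_of_null _ ((1 - b^-1)^-1 *:
  (b^-1 *: ((p * u - (u * p + c *: u')) * v + u * (p * v - (v * p - c *: v')))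
   - ((p * v - (v * p - c *: v')) * u + v * (p * u - (u * p + c *: u')))))).
  by rewrite Ex Ey !(mul0r, mulr0, addr0, scaler0, subrr).
by nc_coefs F R; ring.
Qed.


(** The degree-[m] case of [qbracket_sum]. The step lemmas assume it only in the degrees they use,
    since they serve inside the induction that proves it. *)
Let all_equal m := forall k l, (k + l = m)%N -> qbracket (x k) (y l) = psi m.+1.

Lemma psi1_psi_step m :
  all_equal m -> all_equal m.+1 -> comm psi1 (psi m.+1) = 0.
Proof.
move=> Em Em1; rewrite -(Em 0%N m) // psi1_qbracket (Em1 1%N m) //.
by rewrite (Em1 0%N m.+1) // subrr scaler0.
Qed.

(** For n > 0, psi_{n+1} and psi_n are written as brackets of x_1 and of x_0 with the same y_{n-1};
    the relation is then a combination of multiples of x_1 x_0 = b x_0 x_1. *)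
Lemma psi_x0_step n : all_equal n ->
  psi n.+1 * x 0 - b *: (psi n * x 1) = x 0 * psi n.+1 - b^-1 *: (x 1 * psi n).
Proof.
have E10 := eq_subr0 x1_x0; case: n => [_|n En].
  apply: (eq_of_null (eq_subr0 (psi1_x 0))); rewrite [psi 1]/= -/psi1 /=.
  by move: (c^-1 *: _) => u; rewrite /c; nc_coefs F R; ring.
rewrite -(En 1%N n) // (_ : psi n.+1 = qbracket (x 0) (y n)) // /qbracket.
set v := y n; set u := x 0 in E10 *; set u' := x 1 in E10 *.
apply: (@eq_of_null _ ((1 - b^-1)^-1 *:
  (- (v * (u' * u - b *: (u * u'))) + b^-1 ^+ 2 *: ((u' * u - b *: (u * u')) * v)))).
  by rewrite E10 !(mul0r, mulr0, addr0, oppr0, scaler0).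
by nc_coefs F R; field; rewrite b_neq0 sub1_neq0.
Qed.

Lemma psi_y0_step n : all_equal n.-1 -> all_equal n ->
  psi n.+1 * y 0 - b^-1 *: (psi n * y 1) = y 0 * psi n.+1 - b *: (y 1 * psi n).
Proof.
have E10 := eq_subr0 y0_y1; case: n => [_ _|n En0 En].
  apply: (eq_of_null (eq_subr0 (psi1_y 0))); rewrite [psi 1]/= -/psi1 /=.
  by move: (- c^-1 *: _) => u; rewrite /c; nc_coefs F R; ring.
rewrite -(En n 1%N) ?addn1 // (_ : psi n.+1 = qbracket (x n) (y 0)); last first.
  by rewrite (En0 n 0%N) ?addn0.
rewrite /qbracket; set v := x n; set u := y 0 in E10 *; set u' := y 1 in E10 *.
apply: (@eq_of_null _ ((1 - b^-1)^-1 *: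
  ((u * u' - b *: (u' * u)) * v - b^-1 ^+ 2 *: (v * (u * u' - b *: (u' * u)))))).
  by rewrite E10 !(mul0r, mulr0, addr0, oppr0, scaler0).
by nc_coefs F R; field; rewrite b_neq0 sub1_neq0.
Qed.

(** Bracketing the relation for [j] with psi_1, which commutes with psi_n and psi_{n+1}, gives c
    times the relation for [j.+1]. *)
Lemma psi_x_step n j : comm psi1 (psi n.+1) = 0 -> comm psi1 (psi n) = 0 ->
  psi n.+1 * x j - b *: (psi n * x j.+1) =
    x j * psi n.+1 - b^-1 *: (x j.+1 * psi n) ->
  psi n.+1 * x j.+1 - b *: (psi n * x j.+2) =
    x j.+1 * psi n.+1 - b^-1 *: (x j.+2 * psi n).
Proof.
move=> C1 C0 /eq_subr0; have:= eq_subr0 (psi1_x j); have:= eq_subr0 (psi1_x j.+1).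
move: C1 C0; rewrite /comm.
move: (psi n.+1) (psi n) (x j) (x j.+1) (x j.+2) psi1 => q r u u' u'' p C1 C0 E1 E0 H.
set h := (X in X = 0) in H.
apply: (@eq_of_null _ (c^-1 *: ((p * h - h * p)
  - (p * q - q * p) * u - q * (p * u - (u * p + c *: u'))
  + b *: ((p * r - r * p) * u' + r * (p * u' - (u' * p + c *: u'')))
  + (p * u - (u * p + c *: u')) * q + u * (p * q - q * p)
  - b^-1 *: ((p * u' - (u' * p + c *: u'')) * r + u' * (p * r - r * p))))).
  by rewrite C1 C0 E1 E0 H !(mul0r, mulr0, addr0, oppr0, scaler0).
by rewrite /h; nc_coefs F R; field; rewrite ?b_neq0 c_neq0.
Qed.

Lemma psi_y_step n j : comm psi1 (psi n.+1) = 0 -> comm psi1 (psi n) = 0 ->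
  psi n.+1 * y j - b^-1 *: (psi n * y j.+1) =
    y j * psi n.+1 - b *: (y j.+1 * psi n) ->
  psi n.+1 * y j.+1 - b^-1 *: (psi n * y j.+2) =
    y j.+1 * psi n.+1 - b *: (y j.+2 * psi n).
Proof.
move=> C1 C0 /eq_subr0; have:= eq_subr0 (psi1_y j); have:= eq_subr0 (psi1_y j.+1).
move: C1 C0; rewrite /comm.
move: (psi n.+1) (psi n) (y j) (y j.+1) (y j.+2) psi1 => q r u u' u'' p C1 C0 E1 E0 H.
set h := (X in X = 0) in H.
apply: (@eq_of_null _ (- c^-1 *: ((p * h - h * p)
  - (p * q - q * p) * u - q * (p * u - (u * p - c *: u'))
  + b^-1 *: ((p * r - r * p) * u' + r * (p * u' - (u' * p - c *: u'')))
  + (p * u - (u * p - c *: u')) * q + u * (p * q - q * p)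
  - b *: ((p * u' - (u' * p - c *: u'')) * r + u' * (p * r - r * p))))).
  by rewrite C1 C0 E1 E0 H !(mul0r, mulr0, addr0, oppr0, scaler0).
by rewrite /h; nc_coefs F R; field; rewrite ?b_neq0 c_neq0.
Qed.

(** psi_N is moved to the right past both products of x_0 and y_s; the two expansions carry the same
    coefficients, so they recombine into brackets. *)
Lemma psi_qbracket N s :
  (forall i, (i <= N)%N -> psi i * x 0 =
     \sum_(k < i.+1) qcoef b b^-1 k *: (x k * psi (i - k)%N)) ->
  (forall i, (i <= N)%N -> psi i * y s =
     \sum_(k < i.+1) qcoef b^-1 b k *: (y (s + k)%N * psi (i - k)%N)) ->
  psi N * qbracket (x 0) (y s) =
  \sum_(m < N.+1) \sum_(k < m.+1) (qcoef b b^-1 k * qcoef b^-1 b (m - k)) *: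
     (qbracket (x k) (y (s + (m - k))%N) * psi (N - m)%N).
Proof.
move=> Ex Ey; pose a := qcoef b b^-1; pose a' := qcoef b^-1 b.
have Exy : psi N * (x 0 * y s) = \sum_(m < N.+1) \sum_(k < m.+1)
    (a k * a' (m - k)%N) *: (x k * y (s + (m - k))%N * psi (N - m)%N).
  rewrite mulrA Ex // mulr_suml.
  transitivity (\sum_(k < N.+1) \sum_(l < (N - k).+1)
      (a k * a' l) *: (x k * y (s + l)%N * psi (N - (k + l))%N)).
    apply: eq_bigr => k _; rewrite -scalerAl -mulrA Ey ?leq_subr // !mulr_sumr.
    rewrite scaler_sumr; apply: eq_bigr => l _.
    by rewrite -scalerAr scalerA mulrA subnDA.
  rewrite (sum_triangle (fun k l => (a k * a' l) *: (x k * y (s + l)%N * psi (N - (k + l))%N))).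
  by apply: eq_bigr => m _; apply: eq_bigr => k _; rewrite subnKC // -ltnS.
have Eyx : psi N * (y s * x 0) = \sum_(m < N.+1) \sum_(k < m.+1)
    (a k * a' (m - k)%N) *: (y (s + (m - k))%N * x k * psi (N - m)%N).
  rewrite mulrA Ey // mulr_suml.
  transitivity (\sum_(l < N.+1) \sum_(k < (N - l).+1)
      (a k * a' l) *: (y (s + l)%N * x k * psi (N - (l + k))%N)).
    apply: eq_bigr => l _; rewrite -scalerAl -mulrA Ex ?leq_subr // !mulr_sumr.
    rewrite scaler_sumr; apply: eq_bigr => k _.
    by rewrite -scalerAr scalerA mulrA subnDA mulrC.
  rewrite (sum_triangle (fun l k => (a k * a' l) *: (y (s + l)%N * x k * psi (N - (l + k))%N))).
  apply: eq_bigr => m _.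
  rewrite (sum_antidiag_rev (fun l k => (a k * a' l) *: (y (s + l)%N * x k * psi (N - (l + k))%N))).
  by apply: eq_bigr => k _; rewrite subnK // -ltnS.
rewrite /qbracket -scalerAr mulrBr -scalerAr Exy Eyx scaler_sumr -sumrB.
rewrite scaler_sumr; apply: eq_bigr => m _.
rewrite scaler_sumr -sumrB scaler_sumr; apply: eq_bigr => k _.
by rewrite -/a -/a'; nc_coefs F R; ring.
Qed.

(** By [psi1_qbracket], consecutive brackets of total degree m + 1 differ by c^-1
    [psi_1, psi_{m+1}], so they form an arithmetic progression in [k]. *)
Lemma qbracket_shift m k : all_equal m -> (k <= m.+1)%N ->
  qbracket (x k) (y (m.+1 - k)) =
  qbracket (x 0) (y m.+1) + k%:R *: (c^-1 *: comm psi1 (psi m.+1)).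
Proof.
move=> Em; elim: k => [|k IHk] lt_km; first by rewrite scale0r addr0.
rewrite -natr1 scalerDl scale1r addrA -IHk; last exact: ltnW.
have := psi1_qbracket k (m - k); rewrite Em ?subnKC // => ->.
by rewrite scalerA mulVf // scale1r subSS subSn // addrC subrK.
Qed.

Lemma qbracket_sum m : all_equal m.
Proof.
elim/ltn_ind: m => -[_ [|?] [|?]|m IHm] //.
have Cpsi n : (n <= m)%N -> comm psi1 (psi n) = 0.
  case: n => [_|n lt_nm]; first by rewrite /comm mulr1 mul1r subrr.
  by apply: psi1_psi_step; apply: IHm; rewrite ltnS // ltnW.
have Hx n j : (n.+1 + j <= m.+1)%N -> psi n.+1 * x j - b *: (psi n * x j.+1) =
    x j * psi n.+1 - b^-1 *: (x j.+1 * psi n).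
  elim: j => [|j IHj] le_nj.
    by apply/psi_x0_step/IHm; rewrite addn0 in le_nj.
  have le_nm : (n.+1 <= m)%N by rewrite -ltnS (leq_trans _ le_nj) // addnS ltnS leq_addr.
  by apply: psi_x_step; rewrite ?Cpsi ?IHj // (ltnW, ltnW le_nj) // -addnS.
have Hy n j : (n.+1 + j <= m.+1)%N -> psi n.+1 * y j - b^-1 *: (psi n * y j.+1) =
    y j * psi n.+1 - b *: (y j.+1 * psi n).
  elim: j => [|j IHj] le_nj.
    rewrite addn0 in le_nj; apply: psi_y0_step; apply: IHm => //.
    by rewrite (leq_ltn_trans (leq_pred n)).
  have le_nm : (n.+1 <= m)%N by rewrite -ltnS (leq_trans _ le_nj) // addnS ltnS leq_addr.
  by apply: psi_y_step; rewrite ?Cpsi ?IHj // (ltnW, ltnW le_nj) // -addnS.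
have Ex i : (i <= m.+1)%N ->
    psi i * x 0 = \sum_(k < i.+1) qcoef b b^-1 k *: (x k * psi (i - k)%N).
  by move=> le_im; apply: (qcoef_expand _ Hx); rewrite // addn0.
have Ey i : (i <= m.+1)%N ->
    psi i * y 0 = \sum_(k < i.+1) qcoef b^-1 b k *: (y k * psi (i - k)%N).
  by move=> le_im; apply: (qcoef_expand _ Hy); rewrite // addn0.
(* Write n = m + 1 and qbracket x_k y_(n-k) = qbracket x_0 y_n + k e. Expanding
   psi_n psi_1 with Ex and Ey gives [psi_n, psi_1] = (b^n - b^-n) e, whereas
   [psi_1, psi_n] = c e by definition of e. *)
pose e := c^-1 *: comm psi1 (psi m.+1).
have e0 : e = 0.
  have := psi_qbracket Ex Ey; rewrite -/psi1 big_ord_recr /= subnn.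
  (* In the intermediate degrees the brackets depend on the degree alone by induction, so their
     coefficients add up to 0 by [qcoef_conv]. *)
  rewrite big_ord_recl [X in _ + X + _]big1 ?addr0 => [|i _]; last first.
    transitivity ((\sum_(k < i.+2) qcoef b b^-1 k * qcoef b^-1 b (i.+1 - k)) *:
        (psi i.+2 * psi (m.+1 - i.+1)%N)).
      rewrite scaler_suml; apply: eq_bigr => k _; rewrite add0n.
      by rewrite (IHm i.+1 _ k _ _) // ?ltnS ?subnKC // -ltnS.
    by rewrite qcoef_conv // scale0r.
  rewrite big_ord1 subn0 /= mul1r scale1r => Epsi.
  have : (b ^+ m.+1 - b ^- m.+1 + c) *: e = 0.
    rewrite scalerDl -qcoef_conv_deriv // scaler_suml {2}/e scalerA divff //.
    rewrite scale1r [comm _ _]/comm Epsi -/psi1 -/(psi m.+1) opprD addNKr.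
    apply/eqP; rewrite subr_eq0; apply/eqP.
    transitivity ((\sum_(k < m.+2) qcoef b b^-1 k * qcoef b^-1 b (m.+1 - k)) *:
       qbracket (x 0) (y m.+1) + \sum_(k < m.+2)
       (k%:R * (qcoef b b^-1 k * qcoef b^-1 b (m.+1 - k))) *: e).
      by rewrite qcoef_conv // scale0r add0r.
    rewrite scaler_suml -big_split.
    apply: eq_bigr => k _ /=.
    have le_km : (k <= m.+1)%N by rewrite -ltnS.
    rewrite mulr1 add0n (qbracket_shift (IHm m (ltnSn m)) le_km) -/e.
    by rewrite [RHS]scalerDr; congr (_ + _); rewrite [RHS]scalerA [k%:R * _]mulrC.
  (* For m = 0 the scalar equals 2c, which vanishes in characteristic 2; there e = c^-1
     [psi_1, psi_1] = 0 directly. Otherwise the scalar factors as below, with nonzero factors. *)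
  case: m @e {IHm Cpsi Hx Hy Ex Ey Epsi} => [|m] e.
    by rewrite /e /= -/psi1 /comm subrr scaler0.
  move/eqP; rewrite scaler_eq0 => /orP [|/eqP //].
  rewrite (_ : _ + _ = b ^- m.+2 * (b ^+ m.+3 - 1) * (b ^+ m.+1 + 1)); last first.
    by rewrite /c !exprS; field; rewrite b_neq0 expf_neq0.
  have bm1 : b ^+ m.+1 + 1 != 0.
    apply/eqP => /eqP; rewrite addr_eq0 => /eqP bN1.
    have := @b_nonroot (m.+1 * 2) isT.
    by rewrite exprM bN1 sqrrN expr1n eqxx.
  have bm3 : b ^+ m.+3 - 1 != 0 by rewrite subr_eq0 b_nonroot.
  by rewrite !mulf_eq0 (negPf bm1) (negPf bm3) invr_eq0 expf_eq0 (negPf b_neq0).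
have Ek k : (k <= m.+1)%N -> qbracket (x k) (y (m.+1 - k)) = psi m.+2.
  by move=> le_km; rewrite (qbracket_shift (IHm m (ltnSn m)) le_km) -/e e0 scaler0 addr0.
by move=> k l Ekl; rewrite -(Ek k) -Ekl ?addKn ?leq_addr.
Qed.

Lemma psi1_psi n : comm psi1 (psi n) = 0.
Proof.
case: n => [|n]; first by rewrite /comm mulr1 mul1r subrr.
by apply: psi1_psi_step; apply: qbracket_sum.
Qed.

Lemma psi_x n j :
  psi n.+1 * x j - b *: (psi n * x j.+1) = x j * psi n.+1 - b^-1 *: (x j.+1 * psi n).
Proof.
elim: j => [|j IHj]; first by apply/psi_x0_step/qbracket_sum.
by apply: psi_x_step; rewrite ?psi1_psi.
Qed.

Lemma psi_y n j :
  psi n.+1 * y j - b^-1 *: (psi n * y j.+1) = y j * psi n.+1 - b *: (y j.+1 * psi n).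
Proof.
elim: j => [|j IHj]; first by apply: psi_y0_step; apply: qbracket_sum.
by apply: psi_y_step; rewrite ?psi1_psi.
Qed.

(** psi_m passes [x] and [y] with mutually inverse coefficient series; as the bracket of x_k and y_l
    depends on k + l only, the two effects cancel. *)
Lemma psi_psi m n : psi m * psi n = psi n * psi m.
Proof.
case: n => [|n]; first by rewrite mulr1 mul1r.
rewrite -[psi n.+1]/(qbracket (x 0) (y n)) psi_qbracket => [|i _|i _].
- transitivity (\sum_(k < m.+1)
      (\sum_(l < k.+1) qcoef b b^-1 l * qcoef b^-1 b (k - l)) *:
      (psi (n + k).+1 * psi (m - k)%N)).
    apply: eq_bigr => k _; rewrite scaler_suml; apply: eq_bigr => l _.
    by rewrite (qbracket_sum (m := n + k)) // addnCA subnKC // -ltnS.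
  under eq_bigr => k _ do rewrite qcoef_conv //.
  rewrite big_ord_recl big1 => [|k _]; last by rewrite scale0r.
  by rewrite scale1r addr0 addn0 subn0.
- by apply: (qcoef_expand (N := i)) => // [p j _|]; rewrite ?psi_x ?addn0.
- by apply: (qcoef_expand (N := i + n)) => // p j _; rewrite psi_y.
Qed.

End ImaginaryRootVectors.

(** * Quadratic relations between the root vectors *)

Section QuadraticRelations.
Variables (F : fieldType) (b : F) (R : algType F) (x psi : nat -> R).
Hypothesis b_neq0 : b != 0.
Hypothesis b_nonroot : forall n, (0 < n)%N -> b ^+ n != 1.
Hypothesis psi0 : psi 0 = 1.
Hypothesis Hpsi : forall n j,
  psi n.+1 * x j - b *: (psi n * x j.+1) = x j * psi n.+1 - b^-1 *: (x j.+1 * psi n).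
Hypothesis x1_x0 : x 1 * x 0 = b *: (x 0 * x 1).

Let c := b - b^-1.
Let c_neq0 : c != 0 := subV_neq0 b_neq0 b_nonroot.

Lemma psi_1_x j : psi 1 * x j = x j * psi 1 + c *: x j.+1.
Proof.
apply: (eq_of_null (eq_subr0 (Hpsi 0 j))); rewrite psi0 /c.
by nc_coefs F R; field.
Qed.

Lemma psi_2_x j : psi 2 * x j = x j * psi 2 + c *: (x j.+1 * psi 1 + b *: x j.+2).
Proof.
apply: (@eq_of_null _ ((psi 2 * x j - b *: (psi 1 * x j.+1)) -
    (x j * psi 2 - b^-1 *: (x j.+1 * psi 1)) +
    b *: (psi 1 * x j.+1 - (x j.+1 * psi 1 + c *: x j.+2)))).
  by rewrite Hpsi psi_1_x !subrr scaler0 addr0.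
by rewrite /c; nc_coefs F R; field.
Qed.

Let f i j := x i.+1 * x j - b *: (x i * x j.+1).

Lemma comm_psi_1_f i j : comm (psi 1) (f i j) = c *: (f i.+1 j + f i j.+1).
Proof.
apply: (@eq_of_null _
  ((psi 1 * x i.+1 - (x i.+1 * psi 1 + c *: x i.+2)) * x j
   + x i.+1 * (psi 1 * x j - (x j * psi 1 + c *: x j.+1))
   - b *: ((psi 1 * x i - (x i * psi 1 + c *: x i.+1)) * x j.+1
   + x i * (psi 1 * x j.+1 - (x j.+1 * psi 1 + c *: x j.+2))))).
  by rewrite !psi_1_x !subrr !(mul0r, mulr0, addr0, scaler0, oppr0).
by rewrite /comm /f; nc_coefs F R; ring.
Qed.

(** Induction on [j]. Bracketing [f j j = 0] with psi_1 once and twice, and with psi_2, gives linear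
    relations among the values of [f] two degrees higher, from which [f j.+1 j.+1] is isolated with
    the factor c (b + b^-1), nonzero because b^4 is not 1. *)
Lemma xS_x j : x j.+1 * x j = b *: (x j * x j.+1).
Proof.
suff f0 : f j j = 0 by apply/eqP; rewrite -subr_eq0; apply/eqP.
elim: j => [|j IHj]; first by rewrite /f x1_x0 subrr.
have Ef1 : f j.+1 j + f j j.+1 = 0.
  by apply: (scalerI c_neq0); rewrite -comm_psi_1_f IHj /comm mulr0 mul0r subrr scaler0.
have Ef2 : f j.+2 j + f j.+1 j.+1 + (f j.+1 j.+1 + f j j.+2) = 0.
  apply: (scalerI c_neq0); rewrite scalerDr -!comm_psi_1_f scaler0.
  apply: (@eq_of_null _ (psi 1 * (f j.+1 j + f j j.+1) - (f j.+1 j + f j j.+1) * psi 1)).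
    by rewrite Ef1 mulr0 mul0r subrr.
  by rewrite /comm; nc_coefs F R; ring.
have b2_neq : b * b + 1 != 0.
  apply/eqP => /eqP; rewrite addr_eq0 => /eqP b2.
  by have := @b_nonroot 4 isT; rewrite !exprS expr0 mulr1 mulrA b2 mulN1r opprK eqxx.
have b2_sub1 : b * b - 1 != 0 by rewrite subr_eq0; exact: (@b_nonroot 2).
pose D1 i := psi 1 * x i - (x i * psi 1 + c *: x i.+1).
pose D2 i := psi 2 * x i - (x i * psi 2 + c *: (x i.+1 * psi 1 + b *: x i.+2)).
have D1_0 i : D1 i = 0 by rewrite /D1 psi_1_x subrr.
have D2_0 i : D2 i = 0 by rewrite /D2 psi_2_x subrr.
apply: (@eq_of_null _ (- (c * (b + b^-1))^-1 *:
  (psi 2 * f j j - f j j * psi 2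
   - (D2 j.+1 * x j + x j.+1 * D2 j - b *: (D2 j * x j.+1 + x j * D2 j.+1))
   - c *: (x j.+2 * D1 j - b *: (x j.+1 * D1 j.+1))
   - c *: ((f j.+1 j + f j j.+1) * psi 1)
   - (c * b) *: (f j.+2 j + f j.+1 j.+1 + (f j.+1 j.+1 + f j j.+2))))).
  by rewrite IHj Ef1 Ef2 !D1_0 !D2_0 !(mulr0, mul0r, addr0, scaler0, oppr0).
by rewrite /D1 /D2 /f /c; nc_coefs F R; field; rewrite b_neq0 b2_neq b2_sub1.
Qed.

Let S m j := \sum_(k < m.+1) f (j + k) (j + (m - k)).

Lemma comm_psi_1_S m j : comm (psi 1) (S m j) =
  c *: (S m.+1 j + (if m is m'.+1 then S m' j.+1 else 0)).
Proof.
transitivity (\sum_(k < m.+1) c *: (f (j + k).+1 (j + (m - k)) + f (j + k) (j + (m - k)).+1)).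
  rewrite /comm mulr_sumr mulr_suml -sumrB; apply: eq_bigr => k _.
  exact: comm_psi_1_f.
rewrite -scaler_sumr big_split /= addrC; congr (_ *: _).
rewrite /S [in RHS]big_ord_recr /= -addrA; congr (_ + _).
  by apply: eq_bigr => k _; rewrite subSn ?addnS // -ltnS.
rewrite big_ord_recr /= !subnn addnS addrC; congr (_ + _).
case: m => [|m]; first by rewrite big_ord0.
by apply: eq_bigr => k _; rewrite addSn addSnnS subSn // -ltnS //.
Qed.

(** Induction on [m] for all [j] at once, starting from [xS_x]: the bracket of psi_1 with [S m j] is
    c times the sum of [S m.+1 j] and, for m > 0, of [S m.-1 j.+1]. *)
Lemma S_eq0 m j : S m j = 0.
Proof.
elim/ltn_ind: m j => -[_ j|m IHm j].
  by rewrite /S big_ord1 addn0 /f xS_x subrr.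
apply: (scalerI c_neq0); rewrite scaler0.
have := comm_psi_1_S m j; rewrite IHm // /comm mulr0 mul0r subrr => /esym.
by case: m IHm => [|m] IHm; rewrite ?(IHm m _ j.+1) ?addr0 // ltnW.
Qed.

(** In series form, x_0 x(t) = b x(t) x_0 - (b - 1) x(t)^2. Each half of [S n 0] is the full
    convolution short of one end term. *)
Lemma x0_x n :
  x 0 * x n = b *: (x n * x 0) - (b - 1) *: \sum_(k < n.+1) x k * x (n - k)%N.
Proof.
case: n => [|n].
  by rewrite big_ord1 -scalerBl opprB addrCA subrr addr0 scale1r.
apply: (@eq_of_null _ (- S n 0)); first by rewrite S_eq0 oppr0.
set T := \sum_(k < _) _.
have El : T - x 0 * x n.+1 = \sum_(k < n.+1) x k.+1 * x (n - k)%N.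
  by rewrite /T big_ord_recl addrC addKr.
have Er : T - x n.+1 * x 0 = \sum_(k < n.+1) x k * x (n - k).+1.
  rewrite /T big_ord_recr /= subnn addrK; apply: eq_bigr => k _.
  by rewrite subSn // -ltnS.
have -> : S n 0 = (T - x 0 * x n.+1) - b *: (T - x n.+1 * x 0).
  by rewrite El Er scaler_sumr -sumrB.
by nc_coefs F R; ring.
Qed.

End QuadraticRelations.

(** * Opposite algebras and power series *)

Section ConverseAlgebra.
Variables (F : fieldType) (R : algType F).

HB.instance Definition _ := GRing.Lmodule.on R^c.

Fact converse_scalerAl (c : F) (u v : R^c) : c *: (u * v : R^c) = (c *: u : R^c) * v.
Proof. exact: (@scalerAr F R c v u). Qed.
HB.instance Definition _ := GRing.Lmodule_isLalgebra.Build F R^c converse_scalerAl.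

Fact converse_scalerAr (c : F) (u v : R^c) : c *: (u * v : R^c) = u * (c *: v : R^c).
Proof. exact: (@scalerAl F R c v u). Qed.
HB.instance Definition _ := GRing.Lalgebra_isAlgebra.Build F R^c converse_scalerAr.

End ConverseAlgebra.

(** Formal power series in a central variable t. They are made an algebra over [F] so that
    [nc_coefs] also proves identities between series. *)
Definition series (F : fieldType) (R : algType F) : Type := nat -> R.

Section Series.
Variables (F : fieldType) (R : algType F).
Local Notation S := (series R).
Implicit Types f g h : S.

HB.instance Definition _ := gen_eqMixin S.
HB.instance Definition _ := gen_choiceMixin S.

Let addS f g : S := fun n => f n + g n.
Let oppS f : S := fun n => - f n.
Let zeroS : S := fun=> 0.

Fact series_addA : associative addS.
Proof. by move=> f g h; apply: funext => n; apply: addrA. Qed.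
Fact series_addC : commutative addS.
Proof. by move=> f g; apply: funext => n; apply: addrC. Qed.
Fact series_add0 : left_id zeroS addS.
Proof. by move=> f; apply: funext => n; apply: add0r. Qed.
Fact series_addN : left_inverse zeroS oppS addS.
Proof. by move=> f; apply: funext => n; apply: addNr. Qed.
HB.instance Definition _ :=
  GRing.isZmodule.Build S series_addA series_addC series_add0 series_addN.

Lemma coefDs f g n : (f + g) n = f n + g n. Proof. by []. Qed.
Lemma coefNs f n : (- f) n = - f n. Proof. by []. Qed.

Let mulS f g : S := fun n => \sum_(k < n.+1) f k * g (n - k)%N.
Let oneS : S := fun n => (n == 0%N)%:R.

Fact series_mulA : associative mulS.
Proof.
move=> f g h; apply: funext => n; rewrite /mulS.
transitivity (\sum_(k < n.+1) \sum_(l < (n - k).+1) f k * g l * h (n - (k + l))%N).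
  by apply: eq_bigr => k _; rewrite mulr_sumr; apply: eq_bigr => l _; rewrite mulrA subnDA.
rewrite (sum_triangle (fun k l => f k * g l * h (n - (k + l))%N)).
apply: eq_bigr => m _; rewrite mulr_suml; apply: eq_bigr => k _.
by rewrite subnKC // -ltnS.
Qed.
Fact series_mul1l : left_id oneS mulS.
Proof.
move=> f; apply: funext => n; rewrite /mulS big_ord_recl mul1r subn0.
by rewrite big1 ?addr0 // => k _; rewrite mul0r.
Qed.
Fact series_mul1r : right_id oneS mulS.
Proof.
move=> f; apply: funext => n; rewrite /mulS big_ord_recr /= subnn mulr1.
rewrite big1 ?add0r // => k _; rewrite (_ : oneS _ = 0) ?mulr0 //.
by rewrite /oneS subn_eq0 leqNgt ltn_ord.
Qed.
Fact series_mulDl : left_distributive mulS addS.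
Proof.
move=> f g h; apply: funext => n; rewrite /mulS /addS -big_split.
by apply: eq_bigr => k _; rewrite mulrDl.
Qed.
Fact series_mulDr : right_distributive mulS addS.
Proof.
move=> f g h; apply: funext => n; rewrite /mulS /addS -big_split.
by apply: eq_bigr => k _; rewrite mulrDr.
Qed.
Fact series_1neq0 : oneS != zeroS.
Proof. by apply/eqP => /(congr1 (@^~ 0%N)); apply/eqP/oner_neq0. Qed.
HB.instance Definition _ := GRing.Zmodule_isNzRing.Build S
  series_mulA series_mul1l series_mul1r series_mulDl series_mulDr series_1neq0.

Lemma coefMs f g n : (f * g) n = \sum_(k < n.+1) f k * g (n - k)%N.
Proof. by []. Qed.
Lemma coef1s n : (1 : S) n = (n == 0%N)%:R. Proof. by []. Qed.

Let scaleS (c : F) f : S := fun n => c *: f n.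

Fact series_scaleA a c f : scaleS a (scaleS c f) = scaleS (a * c) f.
Proof. by apply: funext => n; apply: scalerA. Qed.
Fact series_scale1 : left_id 1 scaleS.
Proof. by move=> f; apply: funext => n; apply: scale1r. Qed.
Fact series_scaleDr : right_distributive scaleS +%R.
Proof. by move=> c f g; apply: funext => n; apply: scalerDr. Qed.
Fact series_scaleDl f : {morph scaleS^~ f : a c / a + c >-> a + c}.
Proof. by move=> a c; apply: funext => n; apply: scalerDl. Qed.
HB.instance Definition _ := GRing.Zmodule_isLmodule.Build F S
  series_scaleA series_scale1 series_scaleDr series_scaleDl.

Lemma coefZs c f n : (c *: f) n = c *: f n. Proof. by []. Qed.

Fact series_scaleAl (c : F) f g : c *: (f * g) = (c *: f) * g.
Proof.
apply: funext => n; rewrite coefZs !coefMs scaler_sumr.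
by apply: eq_bigr => k _; rewrite scalerAl.
Qed.
HB.instance Definition _ := GRing.Lmodule_isLalgebra.Build F S series_scaleAl.
Fact series_scaleAr (c : F) f g : c *: (f * g) = f * (c *: g).
Proof.
apply: funext => n; rewrite coefZs !coefMs scaler_sumr.
by apply: eq_bigr => k _; rewrite scalerAr.
Qed.
HB.instance Definition _ := GRing.Lalgebra_isAlgebra.Build F S series_scaleAr.

(* The substitution t := r t. *)
Definition dilate (r : F) f : S := fun n => r ^+ n *: f n.

Lemma dilateM r f g : dilate r (f * g) = dilate r f * dilate r g.
Proof.
apply: funext => n; rewrite /dilate !coefMs scaler_sumr; apply: eq_bigr => k _.
by rewrite -scalerAl -scalerAr scalerA -exprD subnKC // -ltnS.
Qed.
Lemma dilateB r f g : dilate r (f - g) = dilate r f - dilate r g.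
Proof. by apply: funext => n; rewrite /dilate coefDs coefNs scalerBr. Qed.
Lemma dilateZ r c f : dilate r (c *: f) = c *: dilate r f.
Proof. by apply: funext => n; rewrite /dilate !coefZs !scalerA mulrC. Qed.

Definition smono (m : nat) (u : R) : S := fun n => if n == m then u else 0.

Lemma coef_smonol m u f n :
  (smono m u * f) n = if (m <= n)%N then u * f (n - m)%N else 0.
Proof.
rewrite coefMs; case: leqP => [le_mn | lt_nm].
  rewrite -ltnS in le_mn; rewrite (bigD1 (Ordinal le_mn)) //= /smono eqxx.
  by rewrite big1 ?addr0 // => k /negPf; rewrite -val_eqE /= => ->; rewrite mul0r.
rewrite big1 // => k _; rewrite /smono ifN ?mul0r //.
by apply: contraTneq lt_nm => <-; rewrite -leqNgt -ltnS.
Qed.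

Lemma coef_smonor m u f n :
  (f * smono m u) n = if (m <= n)%N then f (n - m)%N * u else 0.
Proof.
rewrite coefMs (sum_antidiag_rev (fun k l => f k * smono m u l)).
case: leqP => [le_mn | lt_nm].
  rewrite -ltnS in le_mn; rewrite (bigD1 (Ordinal le_mn)) //= /smono eqxx.
  by rewrite big1 ?addr0 // => k /negPf; rewrite -val_eqE /= => ->; rewrite mulr0.
rewrite big1 // => k _; rewrite /smono ifN ?mulr0 //.
by apply: contraTneq lt_nm => <-; rewrite -leqNgt -ltnS.
Qed.

Lemma dilate_smono r m u : dilate r (smono m u) = r ^+ m *: smono m u.
Proof.
apply: funext => n; rewrite /dilate coefZs /smono.
by case: eqP => [-> //|_]; rewrite !scaler0.
Qed.

Lemma series_mul_inj f g h : f 0%N = 1 -> f * g = f * h -> g = h.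
Proof.
move=> f0 /(congr1 (fun s : S => s : nat -> R)) Efgh; apply: funext.
elim/ltn_ind => n IHn; have /(congr1 (@^~ n)) := Efgh.
rewrite !coefMs !big_ord_recl f0 !mul1r !subn0.
rewrite (eq_bigr (fun k : 'I_n => f (lift ord0 k) * h (n - lift ord0 k)%N)); last first.
  by move=> k _; rewrite IHn // lift0 ltn_subrL (leq_ltn_trans _ (ltn_ord k)).
by apply: addIr.
Qed.

End Series.

(** [build n] is correct at the indices below [n]; [x0] only starts the construction. This yields
    series whose coefficients refer to all earlier ones. *)
Lemma course_of_values (T : Type) (x0 : T) (Phi : nat -> (nat -> T) -> T) :
  (forall n f g, (forall m, (m < n)%N -> f m = g m) -> Phi n f = Phi n g) ->
  exists f, forall n, f n = Phi n f.
Proof.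
move=> ext_Phi.
pose build := fix build n : nat -> T := if n is m.+1
  then fun k => if (k < m)%N then build m k else Phi k (build m) else fun=> x0.
have buildE n k : (k < n)%N -> build n k = build k.+1 k.
  elim: n => // n IHn; rewrite ltnS leq_eqVlt => /orP[/eqP -> //|lt_kn].
  by rewrite -IHn //= lt_kn.
exists (fun n => build n.+1 n) => n /=; rewrite ltnn.
by apply: ext_Phi => m lt_mn; rewrite buildE.
Qed.

(** * Generating series of the alternating elements *)

Lemma one_addX_neq0 (F : fieldType) (b : F) n :
  (forall m, (0 < m)%N -> b ^+ m != 1) -> (0 < n)%N -> 1 + b ^+ n != 0.
Proof.
move=> b_nonroot n_gt0; apply/eqP => /eqP.
rewrite addrC addr_eq0 => /eqP bN1; have := @b_nonroot (n * 2)%N.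
by rewrite muln_gt0 n_gt0 exprM bN1 sqrrN expr1n eqxx => /(_ isT).
Qed.

(** The recursion for tilde G_n, with [v m] standing for W_{m+1} when [u] is W_0; in the opposite
    algebra [u] is W_1 and [v m] is W_{-m}. *)
Definition tilde_coef (F : fieldType) (b : F) (R : algType F) (u : R)
    (g v : nat -> R) (n : nat) : R :=
  if n is m.+1 then g n + (1 - b^-1)^-1 *: comm u (v m) else 1.

Section AlternatingSeries.
Variables (F : fieldType) (b : F) (R : algType F).
Hypothesis b_neq0 : b != 0.
Hypothesis b_nonroot : forall n, (0 < n)%N -> b ^+ n != 1.

Let bV_nonroot n : (0 < n)%N -> b^-1 ^+ n != 1.
Proof. by move=> n_gt0; rewrite exprVn invr_eq1 b_nonroot. Qed.

Let b1_neq0 : b - 1 != 0 := sub1_neq0 b_nonroot.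

Local Notation S := (series R).
Let SA : algType F := S.

(** P_n is a polynomial in psi_1, ..., psi_n, hence commutes with whatever commutes with every
    psi_k; this later makes the left inverse two-sided. *)
Lemma series_inverse_exists (psi : S) : psi 0%N = 1 ->
  exists P : S, [/\ P 0%N = 1, P * psi = 1 &
    forall u, (forall n, u * psi n = psi n * u) -> forall n, u * P n = P n * u].
Proof.
move=> psi0.
have [|P HP] := @course_of_values R 0 (fun n P =>
    (n == 0%N)%:R - \sum_(k < n) P k * psi (n - k)%N).
  by move=> n f g Efg; congr (_ - _); apply: eq_bigr => k _; rewrite Efg.
exists P; split=> [||u upsi].
- by rewrite HP big_ord0 subr0.
- apply: funext => n; rewrite coefMs big_ord_recr /= subnn psi0 mulr1.
  by rewrite [P n]HP addrC subrK.
elim/ltn_ind=> n IHn; rewrite HP mulrBr mulrBl mulr_sumr mulr_suml.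
congr (_ - _); first by case: eqP; rewrite ?mulr1 ?mul1r ?mulr0 ?mul0r.
by apply: eq_bigr => k _; rewrite mulrA IHn // -!mulrA upsi.
Qed.

(** For n > 0 the coefficient of t^n in gam(t) gam(t/b) is (1 + b^-n) gam_n plus terms in earlier
    coefficients, and 1 + b^-n is invertible since b^(2n) is not 1. *)
Lemma dilated_sqrt_exists (P : S) : P 0%N = 1 ->
  exists gam : S, [/\ gam 0%N = 1, gam * dilate b^-1 gam = P &
    forall u, (forall n, u * P n = P n * u) -> forall n, u * gam n = gam n * u].
Proof.
move=> P0.
have [|g Hg] := @course_of_values R 0 (fun n g => if n is m.+1 then
    (1 + b^-1 ^+ n)^-1 *: (P n - \sum_(k < m) g k.+1 * (b^-1 ^+ (m - k) *: g (m - k)%N))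
    else 1).
  case=> // n f g Efg; congr (_ *: (_ - _)); apply: eq_bigr => k _.
  by rewrite !Efg // ltnS ?leq_subr // ltnW.
have g0 : g 0%N = 1 by rewrite Hg.
exists g; split=> // [|u uP].
  apply: funext => -[|n].
    by rewrite coefMs big_ord1 /dilate expr0 scale1r g0 mulr1.
  rewrite coefMs /dilate big_ord_recl big_ord_recr /= subnn subn0 g0 mul1r.
  rewrite expr0 scale1r mulr1; set s := \sum_(k < n) _.
  have : (1 + b^-1 ^+ n.+1) *: g n.+1 = P n.+1 - s.
    by rewrite Hg scalerA divff ?scale1r // one_addX_neq0.
  by rewrite scalerDl scale1r [g _ + _]addrC => /eqP; rewrite eq_sym subr_eq
    => /eqP ->; rewrite -addrA [g _ + s]addrC.
elim/ltn_ind=> -[_|n IHn]; first by rewrite g0 mulr1 mul1r.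
rewrite Hg -scalerAr -scalerAl; congr (_ *: _).
rewrite mulrBr mulrBl uP mulr_sumr mulr_suml; congr (_ - _).
apply: eq_bigr => k _; rewrite mulrA IHn ?ltnS // -!mulrA; congr (_ * _).
by rewrite -scalerAr -scalerAl IHn // ltnS leq_subr.
Qed.

(** * Relations with W_0, from abstract data so as to apply in the opposite algebra as well *)

Section HalfRelations.
Variables (x y : nat -> R) (psi P gam : S).
Hypothesis psi0 : psi 0%N = 1.
Hypothesis psi_x : forall n j,
  psi n.+1 * x j - b *: (psi n * x j.+1) = x j * psi n.+1 - b^-1 *: (x j.+1 * psi n).
Hypothesis psiE : forall n, psi n.+1 = qbracket b (x 0%N) (y n).
Hypothesis P_psi : P * psi = 1.
Hypothesis psi_P : psi * P = 1.
Hypothesis gam0 : gam 0%N = 1.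
Hypothesis gam_dil : gam * dilate b^-1 gam = P.
Hypothesis dil_gam : dilate b^-1 gam * gam = P.

(* a = gam(t/b), X' = X(t/b), tY = t y(t), eta = tilde G(t). *)
Let a : S := dilate b^-1 gam.
Let X : S := x.
Let x0 : S := smono 0 (x 0%N).
Let X' : S := dilate b^-1 X.
Let tY : S := fun n => if n is m.+1 then y m else 0.
Let eta : S := gam + (1 - b^-1)^-1 *: (x0 * gam * tY - gam * tY * x0).

(** A square root of the relation P (u - b^-1 v) = (u - b v) P, where u = x_j and v = t x_{j+1}. The
    defect [err] satisfies gam(t) err(t/b) + err(t) gam(t/b) = 0, and its first nonzero coefficient
    would be killed by 1 + b^-n. The scalar 1 gives the shape that [qcoef_expand] expects. *)
Lemma gam_x n j :
  gam n.+1 * x j - 1 *: (gam n * x j.+1) = x j * gam n.+1 - b *: (x j.+1 * gam n).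
Proof.
pose u : S := smono 0 (x j); pose v : S := smono 1 (x j.+1).
have psi_uv : psi * (u - b *: v) = (u - b^-1 *: v) * psi.
  apply: funext => m; rewrite mulrBl mulrBr -scalerAl -scalerAr !(coefDs, coefNs, coefZs).
  rewrite !coef_smonol !coef_smonor !subn0 /=.
  by case: m => [|m]; rewrite ?psi0 ?mul1r ?mulr1 ?scaler0 //= subn1 psi_x.
have P_uv : P * (u - b^-1 *: v) = (u - b *: v) * P.
  by rewrite -[LHS]mulr1 -psi_P mulrA -[_ * _ * psi]mulrA -psi_uv !mulrA P_psi mul1r.
pose err : S := gam * (u - v) - (u - b *: v) * gam.
suff err0 : err = 0.
  have := congr1 (fun s : S => s n.+1) err0.
  rewrite /err mulrBl mulrBr -scalerAl !(coefDs, coefNs, coefZs).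
  rewrite !coef_smonol !coef_smonor !subn0 /= subn1 /= scale1r => /eqP.
  by rewrite subr_eq0 => /eqP.
have dil_err : dilate b^-1 err = a * (u - b^-1 *: v) - (u - v) * a.
  rewrite !(dilateB, dilateM, dilateZ, dilate_smono) expr0 expr1 scale1r -/a.
  by rewrite scalerA divff // scale1r.
have err_eq : gam * dilate b^-1 err + err * a = 0.
  have E := eq_subr0 P_uv; rewrite -gam_dil -/a in E; rewrite dil_err /err.
  by apply: (eq_of_null E); nc_coefs F SA; ring.
have err_0 : err 0%N = 0.
  rewrite /err mulrBl mulrBr -scalerAl !(coefDs, coefNs, coefZs).
  by rewrite !coef_smonol !coef_smonor /= gam0 mulr1 mul1r scaler0 !subr0 subrr.
apply: funext => m; change (err m = 0); elim/ltn_ind: m => -[_|m IHm] //.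
have := congr1 (fun s : S => s m.+1) err_eq; rewrite coefDs !coefMs.
rewrite big_ord_recl big1 ?addr0 => [|k _]; last first.
  by rewrite /dilate IHm ?scaler0 ?mulr0 // lift0 subSS ltnS leq_subr.
rewrite big_ord_recr big1 ?add0r => [|k _]; last by rewrite (IHm _ (ltn_ord k)) mul0r.
rewrite -[dilate b^-1 err _]/(b^-1 ^+ m.+1 *: err m.+1).
rewrite /= add0r subnn /a /dilate expr0 scale1r gam0 mulr1 mul1r -{2}[err m.+1]scale1r -scalerDl.
by move/eqP; rewrite scaler_eq0 addrC (negPf (one_addX_neq0 _ _)) // => /eqP.
Qed.

(** Expansion with the coefficients of (1 - bz)/(1 - z) = b - (b - 1)/(1 - z). *)
Lemma gam_x0 : gam * x0 = (b *: x0 - (b - 1) *: X) * gam.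
Proof.
apply: funext => n; rewrite coef_smonor subn0.
rewrite (qcoef_expand (N := n) gam0 (fun n j _ => gam_x n j)) ?addn0 // coefMs.
apply: eq_bigr => k _; rewrite !(coefDs, coefNs, coefZs) /x0 /smono add0n scalerAl.
congr (_ * _); case: k => -[|k] lt_kn /=; last by rewrite scaler0 add0r expr1n mulr1 -scaleNr opprB.
by rewrite -scalerBl opprB addrCA subrr addr0.
Qed.

Lemma a_x0 : a * x0 = (b *: x0 - (b - 1) *: X') * a.
Proof.
have := congr1 (dilate b^-1) gam_x0.
by rewrite !(dilateM, dilateB, dilateZ, dilate_smono) expr0 scale1r.
Qed.

(** The relation [gam_x] at t/b, read in the opposite algebra, expands with the coefficients of (1 -
    z/b)/(1 - z) = b^-1 + (1 - b^-1)/(1 - z). *)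
Lemma x0_a : x0 * a = a * (b^-1 *: x0 + (1 - b^-1) *: X).
Proof.
have a_x n j : (x j : R^c) * (a n.+1 : R^c) - b^-1 *: ((x j.+1 : R^c) * (a n : R^c)) =
    (a n.+1 : R^c) * (x j : R^c) - 1 *: ((a n : R^c) * (x j.+1 : R^c)).
  change (a n.+1 * x j - b^-1 *: (a n * x j.+1) = x j * a n.+1 - 1 *: (x j.+1 * a n)).
  have E := eq_subr0 (gam_x n j); set h := (X in X = 0) in E.
  apply: (@eq_of_null _ (b^-1 ^+ n.+1 *: h)); first by rewrite E scaler0.
  by rewrite /h /a /dilate exprS; nc_coefs F R; field.
have a_x' n j : (n.+1 + j <= n.+1 + j)%N ->
    (a n.+1 : R^c) * (x j : R^c) - 1 *: ((a n : R^c) * (x j.+1 : R^c)) =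
    (x j : R^c) * (a n.+1 : R^c) - b^-1 *: ((x j.+1 : R^c) * (a n : R^c)) by rewrite a_x.
have a0 : (a 0%N : R^c) = 1 by rewrite /a /dilate gam0 expr0 scale1r.
apply: funext => n; rewrite coef_smonol subn0.
have := @qcoef_expand F R^c 1 b^-1 a x n a0 (fun n j _ => a_x' n j (leqnn _)) n 0%N.
rewrite addn0 => /(_ (leqnn n)).
rewrite -[X in X = _]/(x 0%N * a n) => ->.
rewrite coefMs (sum_antidiag_rev (fun i j => a i * _ j)).
apply: eq_bigr => k _; change (qcoef 1 b^-1 k *: (a (n - k)%N * x k) =
  a (n - k)%N * (b^-1 *: x0 + (1 - b^-1) *: X : S) k); rewrite scalerAr.
congr (_ * _); rewrite !(coefDs, coefZs) /x0 /smono.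
case: k => -[|k] lt_kn /=; last by rewrite scaler0 add0r expr1n mulr1.
by rewrite -scalerDl addrCA subrr addr0.
Qed.

Hypothesis x0_xn : forall n,
  x 0%N * x n = b *: (x n * x 0%N) - (b - 1) *: \sum_(k < n.+1) x k * x (n - k)%N.

(** [a_x0] and [x0_a] are two rules for exchanging x_0 with a(t); comparing them leaves this
    relation. *)
Lemma a_X : a * X = X' * a.
Proof.
have e1 := eq_subr0 x0_a; have e2 := eq_subr0 a_x0.
set h1 := (X in X = 0) in e1; set h2 := (X in X = 0) in e2.
apply: (@eq_of_null _ (- (1 - b^-1)^-1 *: (h1 + b^-1 *: h2))).
  by rewrite e1 e2 scaler0 addr0 scaler0.
by rewrite /h1 /h2; nc_coefs F SA; field; rewrite ?b_neq0 ?b1_neq0.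
Qed.

Lemma psi_series : psi = 1 + (1 - b^-1)^-1 *: (b^-1 *: (x0 * tY) - tY * x0).
Proof.
apply: funext => n; rewrite !(coefDs, coefNs, coefZs, coef1s).
rewrite coef_smonol coef_smonor subn0 /=; case: n => [|n]; last by rewrite psiE add0r.
by rewrite psi0 mulr0 mul0r !(scaler0, subr0, addr0).
Qed.

Lemma P_x0 : P * x0 = (b ^+ 2 *: x0 - (b ^+ 2 - 1) *: X') * P.
Proof.
have e1 := eq_subr0 gam_x0; have e2 := eq_subr0 a_x0; have e3 := eq_subr0 a_X.
rewrite -dil_gam -/a; set h1 := (X in X = 0) in e1; set h2 := (X in X = 0) in e2.
set h3 := (X in X = 0) in e3.
apply: (@eq_of_null _ (a * h1 + b *: (h2 * gam) - (b - 1) *: (h3 * gam))).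
  by rewrite e1 e2 e3 !(mulr0, mul0r, scaler0, addr0, oppr0).
by rewrite /h1 /h2 /h3; nc_coefs F SA; ring.
Qed.

(** This is P psi = 1 with psi written out and x_0 carried to the left of P by [P_x0]. *)
Lemma P_series : P + (1 - b^-1)^-1 *: (b *: (x0 * P * tY) - P * tY * x0)
  - (b + 1) *: (X' * P * tY) = 1.
Proof.
have e1 := eq_subr0 P_x0; have e2 := eq_subr0 P_psi; rewrite psi_series in e2.
set h1 := (X in X = 0) in e1; set h2 := (X in X = 0) in e2.
apply: (@eq_of_null _ (h2 - ((1 - b^-1)^-1 * b^-1) *: (h1 * tY))).
  by rewrite e1 e2 !(mul0r, scaler0, addr0, oppr0).
by rewrite /h1 /h2; nc_coefs F SA; field; rewrite ?b_neq0 ?b1_neq0.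
Qed.

(** In terms of the alternating elements: G(t/b) tilde G(t) - t W^-(t/b) W^+(t) = 1. *)
Lemma a_eta : a * eta - X' * P * tY = 1.
Proof.
have e1 := eq_subr0 a_x0; have e2 := eq_subr0 P_series; rewrite -dil_gam -/a in e2 *.
set h1 := (X in X = 0) in e1; set h2 := (X in X = 0) in e2.
apply: (@eq_of_null _ (h2 + (1 - b^-1)^-1 *: (h1 * gam * tY))).
  by rewrite e1 e2 !(mul0r, scaler0, addr0, oppr0).
by rewrite /h1 /h2 /eta; nc_coefs F SA; field; rewrite ?b_neq0 ?b1_neq0.
Qed.

Lemma x0_X : x0 * X = b *: (X * x0) - (b - 1) *: (X * X).
Proof.
apply: funext => n; rewrite !(coefDs, coefNs, coefZs) coef_smonol coef_smonor.
by rewrite subn0 /= coefMs x0_xn.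
Qed.

(** Both sides are multiplied on the left by a(t), which is cancellable; once x_0 has passed a(t),
    [a_eta] eliminates eta. *)
Lemma eta_x0 : b *: (eta * x0) - x0 * eta = (b - 1) *: (X * gam).
Proof.
have a0 : a 0%N = 1 by rewrite /a /dilate gam0 expr0 scale1r.
have e1 := eq_subr0 a_x0; have e2 := eq_subr0 P_series; have e3 := eq_subr0 a_eta.
have e4 := eq_subr0 a_X.
have e5 : x0 * X' - b *: (X' * x0) + (b - 1) *: (X' * X') = 0.
  have dil_x0 : dilate b^-1 x0 = x0 by rewrite dilate_smono expr0 scale1r.
  have /(congr1 (dilate b^-1)) := x0_X.
  rewrite !(dilateM, dilateB, dilateZ) dil_x0 -/X' => ->.
  by nc_coefs F SA; ring.
apply: (series_mul_inj a0); rewrite -dil_gam -/a in e2 e3.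
set h1 := (X in X = 0) in e1; set h2 := (X in X = 0) in e2.
set h3 := (X in X = 0) in e3; set h4 := (X in X = 0) in e4.
set h5 := (X in X = 0) in e5.
apply: (@eq_of_null _ (b *: (h3 * x0) - h1 * eta - (b *: x0 - (b - 1) *: X') * h3
  - b *: (h5 * (a * gam * tY)) - (b - 1) *: (X' * h2) - (b - 1) *: (h4 * gam))).
  by rewrite e1 e2 e3 e4 e5 !(mulr0, mul0r, scaler0, addr0, oppr0).
rewrite /h1 /h2 /h3 /h4 /h5; move: eta => eta'.
by nc_coefs F SA; field; rewrite ?b_neq0 ?b1_neq0.
Qed.

Lemma x0_Xgam : x0 * (X * gam) = X * gam * x0.
Proof.
have e1 := eq_subr0 gam_x0; have e2 := eq_subr0 x0_X.
set h1 := (X in X = 0) in e1; set h2 := (X in X = 0) in e2.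
apply: (@eq_of_null _ (h2 * gam - X * h1)).
  by rewrite e1 e2 !(mulr0, mul0r, addr0, oppr0).
by rewrite /h1 /h2; nc_coefs F SA; ring.
Qed.

(** The candidates for W^-(t) and W^+(t). *)
Let omega : S := X * gam.
Let nu : S := gam * y.

Lemma coef_gam_tY n : (gam * tY) n.+1 = nu n.
Proof.
rewrite coefMs big_ord_recr /= subnn mulr0 addr0; apply: eq_bigr => k _.
by rewrite subSn // -ltnS.
Qed.

Lemma coef_eta0 : eta 0%N = 1.
Proof.
rewrite /eta coefDs coefZs coefDs coefNs -[x0 * gam * tY]mulrA coef_smonol coef_smonor.
by rewrite /= coefMs big_ord1 mulr0 mul0r mulr0 subrr scaler0 addr0 gam0.
Qed.

Lemma coef_etaS n :
  eta n.+1 = gam n.+1 + (1 - b^-1)^-1 *: comm (x 0%N) (nu n).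
Proof.
rewrite /eta coefDs coefZs coefDs coefNs -[x0 * gam * tY]mulrA coef_smonol coef_smonor.
by rewrite subn0 /= coef_gam_tY.
Qed.

Lemma coef_omega n : omega n = (b - 1)^-1 *: bcomm b (x 0%N) (gam n).
Proof.
have /(congr1 (fun s : S => s n)) := gam_x0.
rewrite mulrBl -!scalerAl !(coefDs, coefNs, coefZs) coef_smonor coef_smonol subn0 /=.
move=> /eq_subr0 e; set h := (X in X = 0) in e.
apply: (@eq_of_null _ ((b - 1)^-1 *: h)); first by rewrite e scaler0.
by rewrite /h /bcomm -/omega; nc_coefs F R; field; rewrite b1_neq0.
Qed.

Lemma comm_x0_omega n : comm (x 0%N) (omega n) = 0.
Proof.
have /(congr1 (fun s : S => s n)) := x0_Xgam.
by rewrite coef_smonor coef_smonol subn0 /= => /eq_subr0.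
Qed.

Lemma coef_eta_x0 n : bcomm b (eta n) (x 0%N) = (b - 1) *: omega n.
Proof.
have /(congr1 (fun s : S => s n)) := eta_x0.
by rewrite !(coefDs, coefNs, coefZs) coef_smonor coef_smonol subn0.
Qed.

(* The coefficient of t^n in a_eta is the recursion defining G_n. *)
Lemma gam_rec n : gam n.+1 =
  (1 + b ^- n.+1)^-1 *:
    (\sum_(0 <= k < n.+1) b ^- k *: (omega k * nu (n.+1 - k).-1)
     - \sum_(1 <= k < n.+1) b ^- k *: (gam k * eta (n.+1 - k)%N))
  + ((1 + b ^- n.+1) * (1 - b^-1))^-1 *: comm (nu n) (x 0%N).
Proof.
have e : dilate b^-1 gam * eta - dilate b^-1 omega * (gam * tY) = 1.
  by rewrite /omega dilateM mulrA -[_ * _ * gam]mulrA dil_gam; exact: a_eta.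
have /(congr1 (fun s : S => s n.+1)) := e; rewrite coefDs coefNs !coefMs coef1s /=.
rewrite big_ord_recl big_ord_recr [in X in _ - X]big_ord_recr /= subnn.
rewrite [(gam * tY) 0%N]coefMs big_ord1 /= !mulr0 addr0 subn0 coef_eta0 mulr1.
rewrite {1}/dilate gam0 expr0 scale1r mul1r coef_etaS /comm.
have -> : \sum_(i < n) dilate b^-1 gam (bump 0 i) * eta (n.+1 - bump 0 i)%N =
    \sum_(1 <= k < n.+1) b ^- k *: (gam k * eta (n.+1 - k)%N).
  rewrite big_add1 big_mkord; apply: eq_bigr => i _.
  by rewrite /dilate /bump leq0n add1n -exprVn scalerAl.
have -> : \sum_(i < n.+1) dilate b^-1 omega i * (gam * tY) (n.+1 - i)%N =
    \sum_(0 <= k < n.+1) b ^- k *: (omega k * nu (n.+1 - k).-1).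
  rewrite big_mkord; apply: eq_bigr => i _.
  have -> : (n.+1 - i = (n - i).+1)%N by rewrite subSn // -ltnS.
  by rewrite coef_gam_tY /dilate -exprVn scalerAl.
rewrite -[bump 0 n]/n.+1 /dilate exprVn; set s1 := bigop _ _ _; set s2 := bigop _ _ _.
move=> h0; set h := (X in X = 0) in h0.
have bn : 1 + b ^- n.+1 != 0 by rewrite -exprVn one_addX_neq0.
apply: (@eq_of_null _ ((1 + b ^- n.+1)^-1 *: h)); first by rewrite h0 scaler0.
rewrite /h /comm; move: (b ^- n.+1) bn => r bn; rewrite invfM.
by nc_coefs F R; field; rewrite ?b_neq0 ?b1_neq0 bn.
Qed.

Lemma half_relations n (Gt := tilde_coef b (x 0%N) gam nu) :
  [/\ omega n = (b - 1)^-1 *: bcomm b (x 0%N) (gam n),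
      comm (x 0%N) (omega n) = 0,
      bcomm b (Gt n) (x 0%N) = (b - 1) *: omega n &
      gam n.+1 =
        (1 + b ^- n.+1)^-1 *:
          (\sum_(0 <= k < n.+1) b ^- k *: (omega k * nu (n.+1 - k).-1)
           - \sum_(1 <= k < n.+1) b ^- k *: (gam k * Gt (n.+1 - k)%N))
        + ((1 + b ^- n.+1) * (1 - b^-1))^-1 *: comm (nu n) (x 0%N)].
Proof.
have etaE : eta = Gt.
  by apply: funext => -[|m]; rewrite ?coef_eta0 ?coef_etaS.
rewrite -etaE; split; [exact: coef_omega|exact: comm_x0_omega| |exact: gam_rec].
exact: coef_eta_x0.
Qed.

End HalfRelations.

Lemma series_commute (f g : S) :
  (forall m n, f m * g n = g n * f m) -> f * g = g * f.
Proof.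
move=> fg; apply: funext => n; rewrite !coefMs.
rewrite (sum_antidiag_rev (fun i j => f i * g j)).
by apply: eq_bigr => k _; rewrite fg.
Qed.

Lemma series_converse (f g : S) : (f : series R^c) * (g : series R^c) = g * f :> S.
Proof.
apply: funext => n; rewrite [RHS]coefMs.
by rewrite (sum_antidiag_rev (fun i j => g i * f j)).
Qed.

End AlternatingSeries.

(** * Identification of the alternating elements and their relations with W_0 and W_1 *)

Section AlternatingElements.
Variables (F : fieldType) (b : F) (R : algType F) (w0 w1 : R).
Hypothesis b_neq0 : b != 0.
Hypothesis b_nonroot : forall n, (0 < n)%N -> b ^+ n != 1.
Hypothesis serre01 : qserre b w0 w1 = 0.
Hypothesis serre10 : qserre b w1 w0 = 0.

Lemma alternating_relations n :
  [/\ comm w0 (bcomm b w0 (altG b w0 w1 n)) = 0,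
      comm w0 (bcomm b (altGt b w0 w1 n) w0) = 0,
      comm w1 (bcomm b (altG b w0 w1 n) w1) = 0 &
      comm w1 (bcomm b w1 (altGt b w0 w1 n)) = 0].
Proof.
pose x := rootx b w0 w1; pose y := rooty b w0 w1; pose psi : series R := rootpsi b w0 w1.
have psi_comm m k : psi m * psi k = psi k * psi m by apply: psi_psi.
have [//|P [P0 P_psi P_comm]] := @series_inverse_exists F R psi.
have [//|gam [gam0 gam_dil gam_comm]] := @dilated_sqrt_exists F b R b_nonroot P.
have psi_P : psi * P = 1.
  by rewrite -P_psi; apply: series_commute => m k; apply: P_comm.
have gam_psi m k : psi m * gam k = gam k * psi m.
  by apply: gam_comm => l; apply: P_comm.
have gam_gam m k : gam m * gam k = gam k * gam m.
  by apply: gam_comm => l; apply: P_comm => j; rewrite gam_psi.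
have dil_gam : dilate b^-1 gam * gam = P.
  rewrite -gam_dil; apply: series_commute => i j.
  by rewrite /dilate -scalerAl -scalerAr gam_gam.
pose om : series R := (x : series R) * gam; pose nu : series R := gam * (y : series R).
have psi_x i j : psi i.+1 * x j - b *: (psi i * x j.+1) =
    x j * psi i.+1 - b^-1 *: (x j.+1 * psi i) by apply: psi_x.
have x1_x0 : x 1%N * x 0%N = b *: (x 0%N * x 1%N) by apply: x1_x0.
have xx := x0_x b_neq0 b_nonroot (erefl : psi 0%N = 1) psi_x x1_x0.
have half := @half_relations F b R b_neq0 b_nonroot x y psi P gam erefl psi_x (fun m => erefl)
  P_psi psi_P gam0 gam_dil dil_gam xx.
(* In the opposite algebra [y] satisfies the relations of [x] with the same psi, so the results for
   [x] apply with [x] and [y] exchanged. *)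
have psi_yc i j : (psi i.+1 : R^c) * (y j : R^c) - b *: ((psi i : R^c) * (y j.+1 : R^c)) =
    (y j : R^c) * (psi i.+1 : R^c) - b^-1 *: ((y j.+1 : R^c) * (psi i : R^c)).
  exact: esym (psi_y b_neq0 b_nonroot serre01 serre10 i j).
have y1_y0c : (y 1%N : R^c) * (y 0%N : R^c) = b *: ((y 0%N : R^c) * (y 1%N : R^c)).
  exact: (y0_y1 b_neq0 b_nonroot serre10).
have yy := @x0_x F b R^c y psi b_neq0 b_nonroot erefl psi_yc y1_y0c.
(* The opposite bracket of y_0 and x_m is the bracket of x_m and y_0, which equals that of x_0 and
   y_m by [qbracket_sum]. *)
have psiEc m : psi m.+1 = qbracket b (y 0%N : R^c) (x m : R^c).
  by apply/esym; apply: qbracket_sum => //; rewrite addn0.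
have P_psic : (P : series R^c) * (psi : series R^c) = 1 by rewrite series_converse.
have psi_Pc : (psi : series R^c) * (P : series R^c) = 1 by rewrite series_converse.
have gam_dilc : (gam : series R^c) * dilate b^-1 (gam : series R^c) = P.
  by rewrite series_converse.
have dil_gamc : dilate b^-1 (gam : series R^c) * (gam : series R^c) = P.
  by rewrite series_converse.
have halfc := @half_relations F b R^c b_neq0 b_nonroot y x psi P gam erefl psi_yc psiEc
  P_psic psi_Pc gam0 gam_dilc dil_gamc yy.
have nuE : (y : series R^c) * (gam : series R^c) = nu by rewrite series_converse.
have omE : (gam : series R^c) * (x : series R^c) = om by rewrite series_converse.
pose Gt := tilde_coef b w0 gam nu.
have om_rec m : om m = (b - 1)^-1 *: bcomm b w0 (gam m) by have [] := half m.
have nu_rec m : nu m = (b - 1)^-1 *: bcomm b (gam m) w1.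
  by have [] := halfc m; rewrite nuE.
(* gam_m commutes with psi_1, a combination of [w0 * w1] and [w1 * w0]; this says [W_0, W_{m+1}] =
   [W_{-m}, W_1], so both algebras give the same tilde G. *)
have comm_om_nu m : comm w0 (nu m) = comm (om m) w1.
  have := gam_psi 1%N m; rewrite -[psi 1%N]/(qbracket b w0 w1) => /eq_subr0.
  rewrite om_rec nu_rec /comm /bcomm /qbracket => e; set h := (X in X = 0) in e.
  apply: (@eq_of_null _ (- ((b - 1)^-1 * (b - 1)) *: h)); first by rewrite e scaler0.
  by rewrite /h; nc_coefs F R; field; rewrite ?b_neq0 (sub1_neq0 b_nonroot).
have GtE m : @tilde_coef F b R^c w1 gam om m = Gt m.
  case: m => [//|m]; rewrite /Gt /tilde_coef comm_om_nu; congr (_ + _ *: _).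
(* The recursion determines the alternating elements, so it suffices that the coefficients of the
   series satisfy it. *)
have altE k : [/\ altWm b w0 w1 k = om k, altWp b w0 w1 k = nu k,
    altG b w0 w1 k = gam k & altGt b w0 w1 k = Gt k].
  elim/ltn_ind: k => -[_|k IHk].
    have [-> -> -> ->] := alt0E b w0 w1.
    by rewrite /om /nu !coefMs !big_ord1 gam0 mulr1 mul1r.
  have [_ Ep _ _] := IHk k (ltnSn k).
  have Eg : altG b w0 w1 k.+1 = gam k.+1.
    rewrite altG_rec //= Ep; have [_ _ _ ->] := half k.
    congr (_ *: (_ - _) + _); apply: eq_big_nat => l /andP [l_ge l_lt].
      have [-> _ _ _] := IHk l l_lt.
      have [|_ -> _ _] // := IHk (k.+1 - l).-1.
      by rewrite -subnS subSS ltnS leq_subr.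
    have [_ _ -> _] := IHk l l_lt.
    have [|_ _ _ ->] // := IHk (k.+1 - l)%N.
    by rewrite ltn_subrL l_ge.
  by rewrite altWm_rec // altWp_rec // altGt_rec //= Eg Ep -om_rec -nu_rec.
have [_ _ -> ->] := altE n; split.
- have [E C _ _] := half n; move: C; rewrite E.
  rewrite /comm -scalerAl -scalerAr -scalerBr => /eqP.
  by rewrite scaler_eq0 invr_eq0 (negPf (sub1_neq0 b_nonroot)) => /eqP.
- have [_ C -> _] := half n; move: C; rewrite /comm -scalerAl -scalerAr -scalerBr.
  by move->; rewrite scaler0.
- have [E C _ _] := halfc n; rewrite nuE in E C.
  have {}E : bcomm b (gam n) w1 = (b - 1) *: nu n.
    by rewrite nu_rec scalerA divff ?scale1r // sub1_neq0.
  rewrite E; have {}C : nu n * w1 = w1 * nu n by apply/eqP; rewrite -subr_eq0; apply/eqP.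
  by rewrite /comm -scalerAl -scalerAr C subrr.
have [_ C E _] := halfc n; rewrite nuE omE in C E.
have {}E : bcomm b w1 (Gt n) = (b - 1) *: nu n by rewrite -GtE.
rewrite E; have {}C : nu n * w1 = w1 * nu n by apply/eqP; rewrite -subr_eq0; apply/eqP.
by rewrite /comm -scalerAl -scalerAr C subrr.
Qed.

End AlternatingElements.

(** * Split decompositions *)

Section Resolutions.
Variables (F : fieldType) (V : vectType F) (d : nat).
Implicit Types (E : 'I_d.+1 -> 'End(V)) (A B : 'End(V)) (p : pred 'I_d.+1).

Definition resolution E : Prop :=
  (forall v, \sum_i E i v = v) /\
  (forall i j v, E j (E i v) = if i == j then E i v else 0).

Definition diagonal E A (theta : 'I_d.+1 -> F) : Prop :=
  forall i v, A (E i v) = theta i *: E i v.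

(** The bounds are written additively, which avoids truncated subtraction. *)
Definition shifts (lo hi : nat) E B : Prop :=
  forall i j v, E j (B (E i v)) != 0 -> (i <= j + lo)%N && (j <= i + hi)%N.

Lemma resolution_rev E : resolution E -> resolution (fun i => E (rev_ord i)).
Proof.
case=> E1 EE; split=> [v|i j v] /=; last by rewrite EE (inj_eq rev_ord_inj).
by rewrite -[RHS]E1 [RHS](reindex_inj rev_ord_inj).
Qed.

Lemma shifts_rev lo hi E B : shifts lo hi E B -> shifts hi lo (fun i => E (rev_ord i)) B.
Proof.
move=> EB i j v /EB /=; have := ltn_ord i; have := ltn_ord j; lia.
Qed.

Lemma mem_sum_limg E p v : resolution E ->
  reflect (forall j, ~~ p j -> E j v = 0) (v \in \sum_(j | p j) limg (E j))%VS.
Proof.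
case=> E1 EE; apply: (iffP memv_sumP) => [[vs vs_p ->] j pj|Ev].
  rewrite linear_sum big1 // => i pi; have /memv_imgP [w _ ->] := vs_p i pi.
  by rewrite /= EE; case: eqP => // ij; rewrite ij (negPf pj) in pi.
exists (fun j => E j v) => [i _|]; first exact: memv_img (memvf v).
by rewrite -{1}[v]E1 (bigID p) /= [X in _ + X]big1 ?addr0 // => i /Ev.
Qed.

Lemma shifts_img lo hi E B (p q : pred 'I_d.+1) : resolution E -> shifts lo hi E B ->
  (forall i j : 'I_d.+1, p i -> (i <= j + lo)%N -> (j <= i + hi)%N -> q j) ->
  forall v, v \in (\sum_(j | p j) limg (E j))%VS ->
  B v \in (\sum_(j | q j) limg (E j))%VS.
Proof.
move=> EE EB pq v /(mem_sum_limg _ _ EE) Ev; apply/(mem_sum_limg _ _ EE) => j qj.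
rewrite -[v](proj1 EE) !linear_sum big1 // => i _.
apply/eqP; apply: contraNT qj => /[dup] /EB /andP [l1 l2] nz; apply: pq l1 l2.
by apply: contraNT nz => pi; rewrite Ev // !linear0.
Qed.

Lemma diagonal_coord E A theta : resolution E -> diagonal E A theta ->
  forall j v, E j (A v) = theta j *: E j v.
Proof.
move=> [E1 EE] EA j v; rewrite -{1}[v]E1 !linear_sum (bigD1 j) //= EA linearZ /= EE eqxx.
rewrite big1 ?addr0 // => i /negPf ij.
by rewrite EA linearZ /= EE ij scaler0.
Qed.

(** * The split decomposition of two resolutions with tridiagonal action on each other *)

Section Split.
Variables (E1 E2 : 'I_d.+1 -> 'End(V)) (A1 A2 : 'End(V)).
Variables (theta1 theta2 : 'I_d.+1 -> F).
Hypotheses (res1 : resolution E1) (res2 : resolution E2).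
Hypotheses (diag1 : diagonal E1 A1 theta1) (diag2 : diagonal E2 A2 theta2).
Hypotheses (tri1 : shifts 1 1 E1 A2) (tri2 : shifts 1 1 E2 A1).
Hypothesis irr : forall W : {vspace V},
  (A1 @: W <= W)%VS -> (A2 @: W <= W)%VS -> W = 0%VS \/ W = fullv.
Hypotheses (E1_0 : limg (E1 ord0) != 0%VS) (E2_0 : limg (E2 ord0) != 0%VS).

Local Notation F1 := (sum_upto E1).
Local Notation F2 := (sum_from E2).

Definition split_comp (i : 'I_d.+1) : {vspace V} := (F1 i :&: F2 i)%VS.
Local Notation U := split_comp.

Lemma sum_from_gt m : (d < m)%N -> F2 m = 0%VS.
Proof. by move=> lt_dm; apply: big1 => j; have := ltn_ord j; lia. Qed.

Let W r : {vspace V} := (\sum_(i < d.+1) (F1 i :&: F2 (i + r)))%VS.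

(** On the i-th summand, [A1] minus its i-th eigenvalue kills the top component for [E1] and lowers
    the index for [E2] by at most one, so it maps into the summand of index i - 1, and to 0 for i =
    0. *)
Lemma split_sum_invariant1 r : (A1 @: W r <= W r)%VS.
Proof.
rewrite limg_sum; apply/subv_sumP => i _; apply/subvP => _ /memv_imgP [v + ->].
rewrite memv_cap => /andP [v1 v2]; rewrite -(subrK (theta1 i *: v) (A1 v)).
have vW u (j : 'I_d.+1) : u \in (F1 j :&: F2 (j + r))%VS -> u \in W r.
  by apply/subvP; exact: (sumv_sup j).
apply: memvD; last by apply/memvZ/(vW _ i); rewrite memv_cap v1.
have Ew j : E1 j (A1 v - theta1 i *: v) = (theta1 j - theta1 i) *: E1 j v.
  by rewrite linearB linearZ /= (diagonal_coord res1 diag1) scalerBl.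
have w2 : A1 v - theta1 i *: v \in F2 (i + r).-1.
  apply: memvB.
    apply: (shifts_img res2 tri2 _ v2) => k j; lia.
  by apply/memvZ/(mem_sum_limg _ _ res2) => j jlt;
     move/(mem_sum_limg _ _ res2): v2; apply; lia.
case: (posnP i) => i0.
  suff -> : A1 v - theta1 i *: v = 0 by exact: mem0v.
  rewrite -[LHS](proj1 res1) big1 // => j _; rewrite Ew.
  have [->|ji] := eqVneq j i; first by rewrite subrr scale0r.
  move/(mem_sum_limg _ _ res1): v1 => ->; rewrite ?scaler0 //.
  by move: ji; rewrite -val_eqE /=; lia.
have lti : (i.-1 < d.+1)%N by have := ltn_ord i; lia.
apply: (vW _ (Ordinal lti)); rewrite memv_cap /=; apply/andP; split; last first.
  by rewrite (_ : i.-1 + r = (i + r).-1)%N //; lia.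
apply/(mem_sum_limg _ _ res1) => j ltj; rewrite Ew.
have [->|ji] := eqVneq j i; first by rewrite subrr scale0r.
move/(mem_sum_limg _ _ res1): v1 => ->; rewrite ?scaler0 //.
by move: ji; rewrite -val_eqE /=; lia.
Qed.

(** Dually, [A2] minus its eigenvalue of index i + r kills the lowest component for [E2] and raises
    the index for [E1] by at most one; a summand with i + r > d is zero. *)
Lemma split_sum_invariant2 r : (A2 @: W r <= W r)%VS.
Proof.
rewrite limg_sum; apply/subv_sumP => i _; apply/subvP => _ /memv_imgP [v + ->].
rewrite memv_cap => /andP [v1 v2].
have [lt_d|le_d] := ltnP d (i + r).
  by move: v2; rewrite sum_from_gt // memv0 => /eqP ->; rewrite linear0 mem0v.
pose m : 'I_d.+1 := Ordinal (le_d : (i + r < d.+1)%N).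
rewrite -(subrK (theta2 m *: v) (A2 v)).
have vW u (j : 'I_d.+1) : u \in (F1 j :&: F2 (j + r))%VS -> u \in W r.
  by apply/subvP; exact: (sumv_sup j).
apply: memvD; last by apply/memvZ/(vW _ i); rewrite memv_cap v1.
have w2 : A2 v - theta2 m *: v \in F2 (i + r).+1.
  apply/(mem_sum_limg _ _ res2) => j ltj.
  rewrite linearB linearZ /= (diagonal_coord res2 diag2) -scalerBl.
  have [->|jm] := eqVneq j m; first by rewrite subrr scale0r.
  move/(mem_sum_limg _ _ res2): v2 => ->; rewrite ?scaler0 //.
  by move: jm; rewrite -val_eqE /=; lia.
have w1 : A2 v - theta2 m *: v \in F1 i.+1.
  apply: memvB.
    by apply: (shifts_img res1 tri1 _ v1) => k j; lia.
  by apply/memvZ/(mem_sum_limg _ _ res1) => j jlt;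
     move/(mem_sum_limg _ _ res1): v1; apply; lia.
have [lti|lei] := ltnP i.+1 d.+1.
  by apply: (vW _ (Ordinal lti)); rewrite memv_cap w1.
by move: w2; rewrite sum_from_gt ?memv0 => [/eqP ->|]; [exact: mem0v|lia].
Qed.

Lemma split_sum_irr r : W r = 0%VS \/ W r = fullv.
Proof. exact: irr (split_sum_invariant1 r) (split_sum_invariant2 r). Qed.

(** [W 1] lies in [F2 1], which meets the nonzero space [limg (E2 ord0)] trivially, so
    irreducibility leaves only [W 1 = 0]. *)
Lemma split_cap0 k : (F1 k :&: F2 k.+1)%VS = 0%VS.
Proof.
have [lt_kd|le_dk] := ltnP k d.+1; last by rewrite [F2 _]sum_from_gt ?capv0 //; lia.
apply/eqP; rewrite -subv0; have sub : (F1 k :&: F2 k.+1 <= W 1)%VS.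
  by rewrite -addn1; exact: (sumv_sup (Ordinal lt_kd)).
case: (split_sum_irr 1) => W1; rewrite W1 in sub => //.
case/negP: E2_0; rewrite -subv0; apply/subvP => v v0.
have : v \in W 1 by rewrite W1 memvf.
case/memv_sumP => vs vs_in Ev; have v1 : v \in F2 1.
  rewrite Ev; apply: memv_suml => i _; have := vs_in i isT; rewrite memv_cap => /andP [_].
  by move/(mem_sum_limg _ _ res2) => vsi; apply/(mem_sum_limg _ _ res2) => j jlt;
     apply: vsi; lia.
have {v0} [w Ew] : exists w, v = E2 ord0 w by case/memv_imgP: v0 => w _; exists w.
rewrite memv0 Ew; have := proj2 res2 ord0 ord0 w; rewrite eqxx => <-.
by rewrite -Ew; move/(mem_sum_limg _ _ res2): v1 => ->.
Qed.

(** [W 0] contains the nonzero space [limg (E1 ord0)], because [F2 0] is everything. *)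
Lemma split_full : (\sum_i U i)%VS = fullv.
Proof.
have <- : W 0 = (\sum_i U i)%VS.
  by apply: eq_bigr => i _; rewrite addn0.
case: (split_sum_irr 0) => // W0; case/negP: E1_0; rewrite -subv0 -W0.
apply: (sumv_sup ord0) => //; rewrite subv_cap; apply/andP; split.
  exact: (sumv_sup ord0).
by apply/subvP => v _; apply/(mem_sum_limg _ _ res2).
Qed.

(** In an expansion along [U], the components above k add up to an element of both [F1 k] and
    [F2 k.+1], those below l to an element of both [F1 l.-1] and [F2 l]; both sums vanish by
    [split_cap0]. *)
Lemma split_interval k l : (l <= k)%N ->
  (F1 k :&: F2 l <= \sum_(i < d.+1 | (l <= i <= k)%N) U i)%VS.
Proof.
move=> le_lk; apply/subvP => v; rewrite memv_cap => /andP [v1 v2].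
have : v \in (\sum_i U i)%VS by rewrite split_full memvf.
case/memv_sumP => u uU Ev.
have u1 (i : 'I_d.+1) m : (i <= m)%N -> u i \in F1 m.
  move=> im; have := uU i isT; rewrite memv_cap => /andP [+ _].
  by move/(mem_sum_limg _ _ res1) => ui; apply/(mem_sum_limg _ _ res1) => j jlt;
     apply: ui; lia.
have u2 (i : 'I_d.+1) m : (m <= i)%N -> u i \in F2 m.
  move=> im; have := uU i isT; rewrite memv_cap => /andP [_].
  by move/(mem_sum_limg _ _ res2) => ui; apply/(mem_sum_limg _ _ res2) => j jlt;
     apply: ui; lia.
have Ehi : \sum_(i : 'I_d.+1 | (k < i)%N) u i = 0.
  apply/eqP; rewrite -memv0 -(split_cap0 k) memv_cap; apply/andP; split; last first.
    by apply: memv_suml => i ki; exact: u2.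
  have -> : \sum_(i : 'I_d.+1 | (k < i)%N) u i = v - \sum_(i : 'I_d.+1 | ~~ (k < i)%N) u i.
    by rewrite Ev [X in X - _](bigID (fun i : 'I_d.+1 => (k < i)%N)) /= addrK.
  by apply: memvB => //; apply: memv_suml => i; rewrite -leqNgt; exact: u1.
have Elo : \sum_(i : 'I_d.+1 | (i < l)%N) u i = 0.
  case: l v2 {le_lk} => [|l] v2; first by rewrite big_pred0.
  apply/eqP; rewrite -memv0 -(split_cap0 l) memv_cap; apply/andP; split.
    by apply: memv_suml => i il; exact: u1.
  have -> : \sum_(i : 'I_d.+1 | (i < l.+1)%N) u i =
      v - \sum_(i : 'I_d.+1 | ~~ (i < l.+1)%N) u i.
    by rewrite Ev [X in X - _](bigID (fun i : 'I_d.+1 => (i < l.+1)%N)) /= addrK.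
  by apply: memvB => //; apply: memv_suml => i; rewrite -leqNgt; exact: u2.
rewrite Ev (bigID (fun i : 'I_d.+1 => (k < i)%N)) /= Ehi add0r.
rewrite (bigID (fun i : 'I_d.+1 => (i < l)%N)) /=.
rewrite (eq_bigl (fun i : 'I_d.+1 => (i < l)%N)) => [|i]; last by lia.
rewrite Elo add0r (eq_bigl (fun i : 'I_d.+1 => (l <= i <= k)%N)) => [|i]; last by lia.
by apply: memv_sumr => i _; exact: uU.
Qed.

(** The upper bound comes from the image of [F1 i], the lower one from that of [F2 i]. *)
Lemma split_shift lo1 hi1 lo2 hi2 B i :
  shifts lo1 hi1 E1 B -> shifts lo2 hi2 E2 B ->
  (B @: U i <= \sum_(j < d.+1 | (i - lo2 <= j <= i + hi1)%N) U j)%VS.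
Proof.
move=> B1 B2; have le_lk : (i - lo2 <= i + hi1)%N by lia.
apply: subv_trans (split_interval le_lk).
apply/subvP => _ /memv_imgP [v + ->]; rewrite !memv_cap => /andP [v1 v2].
apply/andP; split.
  by apply: (shifts_img res1 B1 _ v1) => j k; lia.
by apply: (shifts_img res2 B2 _ v2) => j k; lia.
Qed.

End Split.

Lemma limg_shift lo hi E B i : resolution E -> shifts lo hi E B ->
  (B @: limg (E i) <= \sum_(j < d.+1 | (i - lo <= j <= i + hi)%N) limg (E j))%VS.
Proof.
move=> EE EB; apply/subvP => _ /memv_imgP [v v_i ->].
have : v \in (\sum_(j | j == i) limg (E j))%VS by rewrite big_pred1_eq.
by apply: (shifts_img EE EB) => j k /eqP -> ; lia.
Qed.

(** Each boolean is both an offset 0 or 1 of the index and a switch for the neighbouring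
    component. *)
Lemma sum_neighbours (U : 'I_d.+1 -> {vspace V}) (lo hi : bool) (i : 'I_d.+1) :
  (\sum_(j < d.+1 | (i - lo <= j <= i + hi)%N) U j <=
   (if lo then prev_comp U i else 0) + U i + (if hi then next_comp U i else 0))%VS.
Proof.
apply/subv_sumP => j /andP [jlo jhi].
have [ltji|ltij|/val_inj ->] := ltngtP j i; last first.
- by apply: subv_trans (addvSl _ _); exact: addvSr.
- case: hi jhi => jhi; last by lia.
  by apply: subv_trans (addvSr _ _); apply: (sumv_sup j) => //; apply/eqP; lia.
case: lo jlo => jlo; last by lia.
apply: subv_trans (addvSl _ _); apply: subv_trans (addvSl _ _).
by apply: (sumv_sup j) => //; apply/eqP; lia.
Qed.

End Resolutions.

(** * Eigenspaces and primitive idempotents *)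

Section Eigen.
Variables (F : fieldType) (V : vectType F) (d : nat).
Variables (X : 'End(V)) (theta : 'I_d.+1 -> F) (E : 'I_d.+1 -> 'End(V)).
Hypothesis X_diag : diagonalizable_end X.
Hypothesis theta_ord : eigen_ordering X theta.
Hypothesis E_idem : primitive_idempotents X theta E.

Let eig i := passmx.leigenspace X (theta i).

Lemma eigen_decomposition v : exists2 u : 'I_d.+1 -> V,
  forall i, u i \in eig i & v = \sum_i u i.
Proof.
have : v \in (\sum_i eig i)%VS.
  case: X_diag => s Es; move: v (memvf v); apply/subvP; rewrite -Es.
  apply: (big_ind (fun W : {vspace V} => W <= _)%VS) => [|W1 W2|a _].
  - exact: sub0v.
  - by rewrite subv_add => -> ->.
  have [aE|a0] := boolP (passmx.leigenvalue X a).
    by have /(proj2 theta_ord) [i ->] := aE; exact: (sumv_sup i).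
  by move: a0; rewrite negbK => /eqP ->; exact: sub0v.
by case/memv_sumP => u uE ->; exists u => // i; exact: uE.
Qed.

Lemma idem_resolution : resolution E.
Proof.
have EX i j v : E j (E i v) = if i == j then E i v else 0.
  case: (eigen_decomposition v) => u uE ->.
  rewrite linear_sum (bigD1 i) //= (E_idem i (uE i)) eqxx big1 ?addr0.
    by rewrite (E_idem j (uE i)).
  by move=> k /negPf ki; rewrite (E_idem i (uE k)) ki.
split=> // v; case: (eigen_decomposition v) => u uE ->; apply: eq_bigr => i _.
rewrite linear_sum (bigD1 i) //= (E_idem i (uE i)) eqxx big1 ?addr0 //.
by move=> k /negPf ki; rewrite (E_idem i (uE k)) ki.
Qed.

Lemma idem_eig i v : E i v \in eig i.
Proof.
case: (eigen_decomposition v) => u uE ->.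
rewrite linear_sum (bigD1 i) //= (E_idem i (uE i)) eqxx big1 ?addr0 //.
by move=> k /negPf ki; rewrite (E_idem i (uE k)) ki.
Qed.

Lemma idem_diagonal : diagonal E X theta.
Proof.
move=> i v; have := idem_eig i v; rewrite memv_ker !lfun_simp /= subr_eq0.
by move/eqP.
Qed.

Lemma idem_limg i : limg (E i) = eig i.
Proof.
apply/eqP; rewrite eqEsubv; apply/andP; split; apply/subvP => v.
  by case/memv_imgP => w _ ->; exact: idem_eig.
by move=> vi; have := E_idem i vi; rewrite eqxx => <-; rewrite memv_img ?memvf.
Qed.

Lemma idem_neq0 i : limg (E i) != 0%VS.
Proof. by rewrite idem_limg; apply/(proj2 theta_ord); exists i. Qed.

Lemma standard_shifts Y : standard_ordering X Y theta -> shifts 1 1 E Y.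
Proof.
case=> _ XY i j v; have [E1 EE] := idem_resolution; have := XY i.
move/subvP/(_ (Y (E i v)) (memv_img _ (idem_eig i v))).
case/memv_addP => _ /memv_addP [p p_prev [u u_i ->]] [n n_next ->].
have Ep (k : pred 'I_d.+1) w : w \in (\sum_(l | k l) eig l)%VS -> ~~ k j -> E j w = 0.
  move=> wk kj; apply/(mem_sum_limg k w idem_resolution) => //.
  by under eq_bigr do rewrite idem_limg.
rewrite !linearD /=; apply: contraNT => nij.
rewrite (Ep _ p p_prev) ?(Ep _ n n_next) ?(E_idem j u_i); try lia.
by rewrite ifN ?addr0 // -val_eqE /=; lia.
Qed.

(** Between E_j and E_i the relation becomes (theta_j - theta_i)(c theta_j - theta_i) E_j B E_i =
    0. *)
Lemma quadratic_shift c (B : 'End(V)) i j v :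
  (forall u, X (c *: X (B u) - B (X u)) = c *: X (B (X u)) - B (X (X u))) ->
  E j (B (E i v)) != 0 -> theta j = theta i \/ c * theta j = theta i.
Proof.
have EX := diagonal_coord idem_resolution idem_diagonal.
have lZ (f : 'End(V)) a u : f (a *: u) = a *: f u by rewrite linearZ.
move=> /(_ (E i v)) /(congr1 (E j)); rewrite idem_diagonal !lZ idem_diagonal !lZ.
rewrite EX !linearB /= !lZ !EX; set w := E j (B (E i v)) => e w0.
have : ((theta j - theta i) * (c * theta j - theta i)) *: w = 0.
  move/eqP: e; rewrite -subr_eq0 !scalerA -!scalerBl => /eqP <-.
  by congr (_ *: _); ring.
move/eqP; rewrite scaler_eq0 (negPf w0) orbF mulf_eq0 !subr_eq0.
by case/orP => /eqP; [left|right].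
Qed.

End Eigen.

Lemma geometric_eq (F : fieldType) (d : nat) (c : F) (theta : 'I_d.+1 -> F) :
  (0 < d)%N -> c != 0 -> (forall n, (0 < n)%N -> c ^+ n != 1) -> injective theta ->
  (forall i j : 'I_d.+1, j = i.+1 :> nat -> theta j = c * theta i) ->
  forall i j, c * theta i = theta j -> j = i.+1 :> nat.
Proof.
move=> d_gt0 c0 c_nonroot theta_inj theta_step i j.
have theta_pow (k : 'I_d.+1) : theta k = c ^+ k * theta ord0.
  case: k; elim=> [|k IHk] ltk; first by rewrite expr0 mul1r; congr theta; exact: val_inj.
  by rewrite (theta_step (Ordinal (ltnW ltk))) // IHk mulrA exprS.
(* If theta_0 were 0, then theta_1 = c theta_0 would be 0 as well, against injectivity; theta_1
   exists since d > 0. *)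
have theta0 : theta ord0 != 0.
  apply: contraTneq (d_gt0) => t0; rewrite -leqNgt leqNgt; apply/negP => lt_0d.
  have := theta_inj ord0 (Ordinal (lt_0d : 1 < d.+1)%N).
  by rewrite (theta_step ord0 (Ordinal _)) // t0 mulr0 => /(_ erefl) /(congr1 val).
rewrite (theta_pow i) (theta_pow j) mulrA -exprS => /(mulIf theta0).
have cI m n : (m < n)%N -> c ^+ m != c ^+ n.
  move=> lt_mn; rewrite -(subnKC (ltnW lt_mn)) exprD -subr_eq0 -{1}[c ^+ m]mulr1 -mulrBr.
  by rewrite mulf_neq0 ?expf_neq0 // subr_eq0 eq_sym c_nonroot // subn_gt0.
by case: (ltngtP i.+1 j) => [/cI/eqP //|/cI/eqP h e|->] //; case: h.
Qed.

(** * Action on the decompositions *)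

Section Reversal.
Variables (F : fieldType) (V : vectType F) (d : nat) (E : 'I_d.+1 -> 'End(V)).

Lemma sum_from_rev m : (m <= d)%N ->
  sum_from (fun i => E (rev_ord i)) m = sum_upto E (d - m).
Proof.
move=> le_md; rewrite /sum_upto (reindex_inj rev_ord_inj) /=; apply: eq_bigl => j.
by have := ltn_ord j; rewrite /=; lia.
Qed.

Lemma sum_upto_rev m : (m <= d)%N ->
  sum_upto (fun i => E (rev_ord i)) m = sum_from E (d - m).
Proof.
move=> le_md; rewrite /sum_from (reindex_inj rev_ord_inj) /=; apply: eq_bigl => j.
by have := ltn_ord j; rewrite /=; lia.
Qed.

End Reversal.

(** [U] enters through an equation because the decompositions for reversed orderings match
    [split_comp] only after rewriting. *)
Lemma split_neighbours (F : fieldType) (V : vectType F) (d : nat)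
    (E1 E2 : 'I_d.+1 -> 'End(V)) (A1 A2 : 'End(V)) (theta1 theta2 : 'I_d.+1 -> F) :
  resolution E1 -> resolution E2 -> diagonal E1 A1 theta1 -> diagonal E2 A2 theta2 ->
  shifts 1 1 E1 A2 -> shifts 1 1 E2 A1 ->
  (forall W : {vspace V},
    (A1 @: W <= W)%VS -> (A2 @: W <= W)%VS -> W = 0%VS \/ W = fullv) ->
  limg (E1 ord0) != 0%VS -> limg (E2 ord0) != 0%VS ->
  forall U : 'I_d.+1 -> {vspace V}, U = split_comp E1 E2 ->
  forall (lo hi : bool) lo' hi' (B : 'End(V)) i, shifts lo' hi E1 B -> shifts lo hi' E2 B ->
  (B @: U i <= (if lo then prev_comp U i else 0) + U i
               + (if hi then next_comp U i else 0))%VS.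
Proof.
move=> r1 r2 d1 d2 t1 t2 irr n1 n2 U -> lo hi lo' hi' B i B1 B2.
apply: subv_trans (sum_neighbours _ lo hi i).
exact: (split_shift r1 r2 d1 d2 t1 t2 irr n1 n2 i B1 B2).
Qed.

Lemma act_quadratic (F : fieldType) (U : algType F) (V : vectType F)
    (act : U -> 'End(V)) (c : F) (w u : U) :
  module_action act -> comm w (bcomm c w u) = 0 -> forall v,
  act w (c *: act w (act u v) - act u (act w v)) =
  c *: act w (act u (act w v)) - act u (act w (act w v)).
Proof.
case=> act_lin _ act_mul /eqP; rewrite subr_eq0 => /eqP e v.
have actB x y : act (x - y) = act x - act y.
  by rewrite -scaleN1r addrC act_lin scaleN1r addrC.
have act0 : act 0 = 0 by rewrite -(subrr 0) actB subrr.
have actZ a x : act (a *: x) = a *: act x.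
  by rewrite -[a *: x]addr0 act_lin act0 addr0.
have := congr1 (fun x => act x v) e; rewrite /bcomm !act_mul !actB !actZ !act_mul.
by rewrite !lfunE /= !lfunE /= !lfunE /= !lfunE.
Qed.

(** [u, w]_b = -b [w, u]_{b^-1}; this gives the form that [act_quadratic] takes. *)
Lemma comm_bcomm_flip (F : fieldType) (R : algType F) (b : F) (w u : R) :
  b != 0 -> comm w (bcomm b u w) = 0 -> comm w (bcomm b^-1 w u) = 0.
Proof.
move=> b_neq0 h; apply: (@eq_of_null _ (- b^-1 *: comm w (bcomm b u w))).
  by rewrite h scaler0.
by rewrite /comm /bcomm; nc_coefs F R; field.
Qed.

Theorem theorem9p9 (F : fieldType)
  (* K is an algebraic closure of F, with embedding iota *)
  (K : closedFieldType) (iota : {rmorphism F -> K})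
  (K_alg : forall x : K, algebraicOver iota x)
  (q : K) (q_neq0 : q != 0)
  (q_nonroot : forall n : nat, (0 < n)%N -> q ^+ n != 1)
  (b : F) (b_def : iota b = q ^+ 2)
  (V : vectType F) (V_neq0 : (0 < \dim {:V})%N)
  (d : nat) (d_ge1 : (1 <= d)%N)
  (A As : 'End(V)) (theta thetas : 'I_d.+1 -> F) (E Es : 'I_d.+1 -> 'End(V))
  (Phi : td_system A theta E As thetas Es)
  (Phi_qserre : qserre_type b theta thetas)
  (act : Uqp b -> 'End(V)) (act_module : module_action act)
  (act_W0 : act (W0 b) = A) (act_W1 : act (W1 b) = As) :
  forall (k : nat) (i : 'I_d.+1),
  let G := act (UG b k.+1) in
  let Gt := act (UGt b k.+1) in
  [/\
    (forall U : 'I_d.+1 -> {vspace V},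
       U = dec_0_D E \/ U = dec_0s_Ds Es \/ U = dec_0s_D E Es ->
       (G @: U i <= prev_comp U i + U i)%VS /\
       (Gt @: U i <= U i + next_comp U i)%VS),
    (let U := dec_0s_0 E Es in
       (G @: U i <= U i)%VS /\
       (Gt @: U i <= prev_comp U i + U i + next_comp U i)%VS),
    (let U := dec_Ds_0 E Es in
       (G @: U i <= U i + next_comp U i)%VS /\
       (Gt @: U i <= prev_comp U i + U i)%VS) &
    (let U := dec_Ds_D E Es in
       (G @: U i <= prev_comp U i + U i + next_comp U i)%VS /\
       (Gt @: U i <= U i)%VS)].
Proof.
have b_neq0 : b != 0 by rewrite -(fmorph_eq0 iota) b_def expf_neq0.
have b_nonroot n : (0 < n)%N -> b ^+ n != 1.
  move=> n_gt0; rewrite -(fmorph_eq1 iota) rmorphXn /= b_def -exprM.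
  by apply: q_nonroot; rewrite muln_gt0.
have bV_neq0 : b^-1 != 0 by rewrite invr_eq0.
have bV_nonroot n : (0 < n)%N -> b^-1 ^+ n != 1.
  by move=> n_gt0; rewrite exprVn invr_eq1 b_nonroot.
case: Phi => -[A_diag As_diag _ _ irr] A_std E_idem As_std Es_idem.
have irrW (W : {vspace V}) :
    (As @: W <= W)%VS -> (A @: W <= W)%VS -> W = 0%VS \/ W = fullv.
  move=> AsW AW; have [|W0] := eqVneq W 0%VS; first by left.
  have [|Wf] := eqVneq W fullv; first by right.
  by case: irr; exists W; split=> //; apply/eqP.
have A_ord := proj1 A_std; have As_ord := proj1 As_std.
have r := idem_resolution A_diag A_ord E_idem.
have rs := idem_resolution As_diag As_ord Es_idem.
have D := idem_diagonal A_diag A_ord E_idem.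
have Ds := idem_diagonal As_diag As_ord Es_idem.
have tE := standard_shifts A_diag A_ord E_idem A_std.
have tEs := standard_shifts As_diag As_ord Es_idem As_std.
have nz := idem_neq0 A_diag A_ord E_idem.
have nzs := idem_neq0 As_diag As_ord Es_idem.
have next i j : b * theta i = theta j -> j = i.+1 :> nat.
  by apply: geometric_eq => //; [exact: (proj1 A_ord) | move=> x y /Phi_qserre []].
have nexts i j : b^-1 * thetas i = thetas j -> j = i.+1 :> nat.
  by apply: geometric_eq => //; [exact: (proj1 As_ord) | move=> x y /Phi_qserre []].
move=> k i G Gt.
have [R1 R2 R3 R4] := alternating_relations b_neq0 b_nonroot (Uqp_rel0 b) (Uqp_rel1 b) k.+1.
have {}R2 := comm_bcomm_flip b_neq0 R2; have {}R3 := comm_bcomm_flip b_neq0 R3.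
have Q1 := act_quadratic act_module R1; have Q2 := act_quadratic act_module R2.
have Q3 := act_quadratic act_module R3; have Q4 := act_quadratic act_module R4.
rewrite act_W0 -/(UG b k.+1) -/G in Q1; rewrite act_W0 -/(UGt b k.+1) -/Gt in Q2.
rewrite act_W1 -/(UG b k.+1) -/G in Q3; rewrite act_W1 -/(UGt b k.+1) -/Gt in Q4.
have th_inj := proj1 A_ord; have ths_inj := proj1 As_ord.
(* Besides equal indices, the quadratic relation allows only b theta_n = theta_m, that is m = n + 1.
   The three other cases are analogous. *)
have GE : shifts 1 0 E G.
  move=> m n v nz_n; have := quadratic_shift A_diag A_ord E_idem Q1 nz_n.
  by case=> [/th_inj -> | /next ->]; lia.
have GtE : shifts 0 1 E Gt.
  move=> m n v nz_n; have := quadratic_shift A_diag A_ord E_idem Q2 nz_n.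
  case=> [/th_inj -> | e]; first lia.
  have /next -> : b * theta m = theta n by rewrite -e mulrA divff // mul1r.
  by lia.
have GEs : shifts 1 0 Es G.
  move=> m n v nz_n; have := quadratic_shift As_diag As_ord Es_idem Q3 nz_n.
  by case=> [/ths_inj -> | /nexts ->]; lia.
have GtEs : shifts 0 1 Es Gt.
  move=> m n v nz_n; have := quadratic_shift As_diag As_ord Es_idem Q4 nz_n.
  case=> [/ths_inj -> | e]; first lia.
  have /nexts -> : b^-1 * thetas m = thetas n by rewrite -e mulrA mulVf // mul1r.
  by lia.
have Dr : diagonal (fun j => E (rev_ord j)) A (fun j => theta (rev_ord j)).
  by move=> j v; exact: D.
have Dsr : diagonal (fun j => Es (rev_ord j)) As (fun j => thetas (rev_ord j)).
  by move=> j v; exact: Ds.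
have le_d (j : 'I_d.+1) : (j <= d)%N by rewrite -ltnS.
(* One construction gives the four split decompositions: [dec_0s_D] from [Es] and [E], [dec_0s_0]
   with [E] reversed, [dec_Ds_D] with [Es] reversed, [dec_Ds_0] with both. Reversal exchanges
   raising and lowering, whence the different shapes of the inclusions. *)
have S0D := split_neighbours rs r Ds D tEs tE irrW (nzs _) (nz _)
  (erefl : dec_0s_D E Es = _).
have S00 := split_neighbours rs (resolution_rev r) Ds Dr tEs (shifts_rev tE)
  irrW (nzs _) (nz _).
have SD0 := split_neighbours (resolution_rev rs) (resolution_rev r) Dsr Dr
  (shifts_rev tEs) (shifts_rev tE) irrW (nzs _) (nz _).
have SDD := split_neighbours (resolution_rev rs) r Dsr D
  (shifts_rev tEs) tE irrW (nzs _) (nz _).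
have {}S00 := S00 (dec_0s_0 E Es) _; have {}SD0 := SD0 (dec_Ds_0 E Es) _.
have {}SDD := SDD (dec_Ds_D E Es) _.
have E00 : dec_0s_0 E Es = split_comp Es (fun j => E (rev_ord j)).
  by apply: funext => j; rewrite /split_comp sum_from_rev.
have ED0 : dec_Ds_0 E Es = split_comp (fun j => Es (rev_ord j)) (fun j => E (rev_ord j)).
  by apply: funext => j; rewrite /split_comp sum_from_rev // sum_upto_rev.
have EDD : dec_Ds_D E Es = split_comp (fun j => Es (rev_ord j)) E.
  by apply: funext => j; rewrite /split_comp sum_upto_rev.
split.
- move=> U [->|[->|->]]; split.
  + apply: subv_trans (limg_shift i r GE) _.
    by apply: subv_trans (sum_neighbours _ true false i) _; rewrite addv0.
  + apply: subv_trans (limg_shift i r GtE) _.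
    by apply: subv_trans (sum_neighbours _ false true i) _; rewrite add0v.
  + apply: subv_trans (limg_shift i rs GEs) _.
    by apply: subv_trans (sum_neighbours _ true false i) _; rewrite addv0.
  + apply: subv_trans (limg_shift i rs GtEs) _.
    by apply: subv_trans (sum_neighbours _ false true i) _; rewrite add0v.
  + by have := S0D true false _ _ G i GEs GE; rewrite addv0.
  + by have := S0D false true _ _ Gt i GtEs GtE; rewrite add0v.
- split; first by have := S00 E00 false false _ _ G i GEs (shifts_rev GE); rewrite addv0 add0v.
  exact: S00 E00 true true _ _ Gt i GtEs (shifts_rev GtE).
- split.
    by have := SD0 ED0 false true _ _ G i (shifts_rev GEs) (shifts_rev GE); rewrite add0v.
  by have := SD0 ED0 true false _ _ Gt i (shifts_rev GtEs) (shifts_rev GtE); rewrite addv0.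
split; first exact: SDD EDD true true _ _ G i (shifts_rev GEs) GE.
by have := SDD EDD false false _ _ Gt i (shifts_rev GtEs) GtE; rewrite addv0 add0v.
Qed.
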